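(* Let $m\ge 3$ and let $\mathfrak g$ be the simple Lie algebra of type $D_m$. (1) Let $1\le i<j\le m-1$ and $J=\{i,i+1,\dots,j\}$. Then, as maps on $B(n\varpi_1)$ for every $n\ge1$, $$c_J\sim (c_jt_{j-1}t_{j-2}\cdots t_i)(c_jt_{j-1}\cdots t_{i+1})\cdots(c_jt_{j-1})\,c_j .$$ (2) Let $1\le i\le m-2$ and $J=\{i,i+1,\dots,m-2,m\}$. Then, as maps on $B(n\varpi_1)$ for every $n\ge1$, $$c_J\sim (c_mt_{m-2}t_{m-3}\cdots t_i)(c_mt_{m-2}\cdots t_{i+1})\cdots(c_mt_{m-2})\,c_m .$$
   Context: Setting. $I=\{1,\dots,m\}$ is the Dynkin diagram of type $D_m$ with spin nodes $m-1,m$ (both adjacent to $m-2$; $i$ is adjacent to $i+1$ for $i\le m-2$), $\alpha_i=\epsilon_i-\epsilon_{i+1}$ for $i\le m-1$, $\alpha_m=\epsilon_{m-1}+\epsilon_m$, $W=\langle s_i\rangle$ is the Weyl group. The crystal $B(n\varpi_1)$ is the set of rows $b_1b_2\cdots b_n$ of length $n$, weakly increasing in the poset $1<2<\dots<m-1<m,\overline m<\overline{m-1}<\dots<\overline 1$ in which $m$ and $\overline m$ are incomparable (so $m,\overline m$ never both appear). The weight is the sum of the weights of the entries, $\mathrm{wt}(i)=\epsilon_i$, $\mathrm{wt}(\overline i)=-\epsilon_i$. On single letters: $f_i(i)=i+1$, $f_i(\overline{i+1})=\overline i$ for $1\le i\le m-1$; $f_m(m-1)=\overline m$, $f_m(m)=\overline{m-1}$;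 all other $f_i$ of letters are $0$; $e_i(x)=y$ iff $f_i(y)=x$. On a row, for fixed $i$, write from left to right a $+$ for each letter $x$ with $f_i(x)\ne0$ and a $-$ for each letter with $e_i(x)\neq 0$, successively cancel pairs $-+$, leaving $+\cdots+-\cdots-$; $f_i$ applies $f_i$ to the letter of the rightmost uncancelled $+$ (result $0$ if none) and $e_i$ applies $e_i$ to the letter of the leftmost uncancelled $-$ (result $0$ if none). Cactus action. For connected $J\subseteq I$ let $w_{0,J}$ be the longest element of $W_J=\langle s_j: j\in J\rangle$ and $\theta_J:J\to J$ be given by $\alpha_{\theta_J(j)}=-w_{0,J}\alpha_j$. Then $c_J$ acts on $B(n\varpi_1)$ as the unique map preserving each connected component of the crystal restricted to $J$ (keep only edges labelled by $J$) and satisfying $\mathrm{wt}(c_J b)=w_{0,J}\mathrm{wt}(b)$, $e_j c_J(b)=c_J(f_{\theta_J(j)}b)$, $f_jc_J(b)=c_J(e_{\theta_J(j)}b)$ for $j\in J$ (with $c_J(0)=0$). Write $c_k=c_{\{k\}}$. Toggles (acting on $B(n\varpi_1)$; after the operation the entries are re-sorted into a row). For $1\le i\le m-2$, $t_i$ replaces every $i$ by $i+1$ and vice versa, and every $\overline i$ by $\overline{i+1}$ and vice versa. Products are compositions of maps (rightmost applied first), and $\sim$ means equality as maps on $B(n\varpi_1)$ for all $n\ge1$. *)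

(* Defs.v *)
From HB Require Import structures.
From mathcomp Require Import all_boot all_order all_algebra.
From mathcomp Require Import boolp classical_sets.

Set Implicit Arguments.
Unset Strict Implicit.
Unset Printing Implicit Defensive.

Import GRing.Theory.
Local Open Scope ring_scope.

(* Nodes of the Dynkin diagram, and indices of letters, are elements of 'I_m
   carrying the labels 1, ..., m.  All formulas below are written in labels. *)
Definition lab (m : nat) (k : 'I_m) : nat := k.+1.

(** Roots and Weyl group of type D_m, acting on the column vectors Z^m. *)

Definition eps (m k : nat) : 'cV[int]_m := \col_(l < m) (lab l == k)%:R.

Definition alpha (m : nat) (i : 'I_m) : 'cV[int]_m :=
  if (lab i < m)%N then eps m (lab i) - eps m (lab i).+1
  else eps m m.-1 + eps m m.

(* Matrix of v |-> v - (v, alpha_i) alpha_i; since (alpha_i, alpha_i) = 2, the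
   coroot of alpha_i is alpha_i itself. *)
Definition srefl (m : nat) (i : 'I_m) : 'M[int]_m :=
  1%:M - alpha i *m (alpha i)^T.

Definition weyl_word (m : nat) (u : seq 'I_m) : 'M[int]_m :=
  \prod_(i <- u) srefl i.

(* u is a shortest expression, in the generators s_j (j in J), of an element
   of W_J. *)
Definition reduced (m : nat) (J : {set 'I_m}) (u : seq 'I_m) : Prop :=
  all (mem J) u /\
  forall v : seq 'I_m,
    all (mem J) v -> weyl_word v = weyl_word u -> (size u <= size v)%N.

Definition longest (m : nat) (J : {set 'I_m}) (w : 'M[int]_m) : Prop :=
  exists u : seq 'I_m,
    [/\ reduced J u, weyl_word u = w &
        forall v : seq 'I_m, reduced J v -> (size v <= size u)%N].

Definition w0 (m : nat) (J : {set 'I_m}) : 'M[int]_m :=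
  xget 1%:M [set w | longest J w]%classic.

(* The default value is never reached when j \in J. *)
Definition theta (m : nat) (J : {set 'I_m}) (j : 'I_m) : 'I_m :=
  odflt j [pick k in J | alpha k == - (w0 J *m alpha j)].

(** Letters: (k, false) is the letter k and (k, true) the letter \bar k. *)

Definition letter (m : nat) : Type := ('I_m * bool)%type.
HB.instance Definition _ (m : nat) := Finite.on (letter m).

Definition code (m : nat) (x : letter m) : nat * bool := (lab x.1, x.2).

(* m and \bar m have the same rank, and are thus incomparable for lel. *)
Definition rank (m : nat) (x : letter m) : nat :=
  if x.2 then (m.*2 - lab x.1)%N else lab x.1.

Definition lel (m : nat) : rel (letter m) :=
  fun x y => (x == y) || (rank x < rank y)%N.

Definition wt_letter (m : nat) (x : letter m) : 'cV[int]_m :=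
  if x.2 then - eps m (lab x.1) else eps m (lab x.1).

(* The edges f_i(x) = y of the crystal of letters. *)
Definition fedge (m : nat) (i : 'I_m) (x y : letter m) : bool :=
  (code x, code y) \in
    (if (lab i < m)%N then
       [:: ((lab i, false), ((lab i).+1, false));
           (((lab i).+1, true), (lab i, true))]
     else
       [:: ((m.-1, false), (m, true)); ((m, false), (m.-1, true))]).

(* Here and for rows, None stands for 0. *)
Definition f_letter (m : nat) (i : 'I_m) (x : letter m) : option (letter m) :=
  [pick y | fedge i x y].

Definition e_letter (m : nat) (i : 'I_m) (x : letter m) : option (letter m) :=
  [pick y | fedge i y x].

(** The crystal B(n varpi_1). *)

Record B (m n : nat) : Type :=
  Row { row_val :> n.-tuple (letter m); _ : sorted (@lel m) row_val }.
HB.instance Definition _ (m n : nat) := [isSub for @row_val m n].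
HB.instance Definition _ (m n : nat) := [Finite of B m n by <:].

Definition wt (m n : nat) (b : B m n) : 'cV[int]_m :=
  \sum_(p < n) wt_letter (tnth b p).

(* The signs of b with their positions; + is true and - is false. *)
Definition signature (m n : nat) (i : 'I_m) (b : B m n) : seq (bool * 'I_n) :=
  [seq (isSome (f_letter i (tnth b p)), p) | p <- enum 'I_n
     & isSome (f_letter i (tnth b p)) || isSome (e_letter i (tnth b p))].

(* Successive cancellation of adjacent pairs -+.  The accumulator st is the
   part already reduced, in reverse order. *)
Fixpoint cancel_pairs (T : Type) (st s : seq (bool * T)) : seq (bool * T) :=
  match s, st with
  | [::], _ => rev st
  | (true, _) :: s', (false, _) :: st' => cancel_pairs st' s'
  | x :: s', _ => cancel_pairs (x :: st) s'
  end.

Definition uncancelled (m n : nat) (i : 'I_m) (b : B m n) (sg : bool) :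
    seq 'I_n :=
  [seq x.2 | x <- cancel_pairs [::] (signature i b) & x.1 == sg].

(* insub: the word obtained is always a row when b is one. *)
Definition act_at (m n : nat) (g : letter m -> option (letter m))
    (b : B m n) (p : 'I_n) : option (B m n) :=
  obind (fun y => insub [tuple if q == p then y else tnth b q | q < n])
        (g (tnth b p)).

Definition f (m n : nat) (i : 'I_m) (b : B m n) : option (B m n) :=
  obind (act_at (f_letter i) b) (ohead (rev (uncancelled i b true))).

Definition e (m n : nat) (i : 'I_m) (b : B m n) : option (B m n) :=
  obind (act_at (e_letter i) b) (ohead (uncancelled i b false)).

(** The cactus action. *)

Definition edge (m n : nat) (J : {set 'I_m}) : rel (B m n) :=
  fun b b' => [exists j in J, (f j b == Some b') || (f j b' == Some b)].

Definition cactus_spec (m n : nat) (J : {set 'I_m})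
    (c : {ffun B m n -> B m n}) : Prop :=
  forall b : B m n,
    [/\ connect (@edge m n J) b (c b),
        wt (c b) = w0 J *m wt b &
        forall j : 'I_m, j \in J ->
          e j (c b) = omap c (f (theta J j) b) /\
          f j (c b) = omap c (e (theta J j) b)].

(* The map singled out by cactus_spec, for J connected in the diagram; it exists
   and is unique, so that the default value of xget plays no role. *)
Definition cactus (m n : nat) (J : {set 'I_m}) : {ffun B m n -> B m n} :=
  xget [ffun b => b] [set c | cactus_spec J c]%classic.

Definition cactus1 (m n k : nat) : B m n -> B m n :=
  cactus n [set l : 'I_m | lab l == k].

(** Toggles. *)

Definition swap_label (i k : nat) : nat :=
  if k == i then i.+1 else if k == i.+1 then i else k.

Definition toggle_letter (m i : nat) (x : letter m) : letter m :=
  odflt x [pick y : letter m | code y == (swap_label i (lab x.1), x.2)].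

(* For i <= m - 2 the result never contains both m and \bar m, so that lel is
   total on its letters and the sorted word is a row. *)
Definition toggle (m n i : nat) (b : B m n) : B m n :=
  insubd b [tuple of sort (@lel m) (map (toggle_letter i) b)].

(** Products of maps. *)

Definition compose (T : Type) (s : seq (T -> T)) : T -> T :=
  foldr (fun g h => g \o h) id s.

(* (c t_{j-1} ... t_i) (c t_{j-1} ... t_{i+1}) ... (c t_{j-1}) c *)
Definition toggle_product (m n : nat) (c : B m n -> B m n) (i j : nat) :
    B m n -> B m n :=
  compose
    [seq c \o compose [seq @toggle m n l | l <- rev (index_iota k j)]
       | k <- index_iota i j.+1].

(* Main.v *)
Require Import Defs.
From mathcomp Require Import all_boot all_order all_algebra.
From mathcomp Require Import all_fingroup zify.

(** Let X_p and Y_p be the numbers of letters p and \bar p of a row, and put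
    u_p = X_p - Y_p and z_p = min (X_p, Y_p); since m and \bar m do not both
    occur, z_m = 0, and the row is determined by u and z.  For k < m, f_k lowers
    u_k, raises u_{k+1} and changes no entry of z but z_k.  From this one reads
    off that c_J, for J = {i, ..., j}, reverses u on [i, j+1] and z on [i, j]:
    this map intertwines f_k with e_{i+j-k}, and it preserves the
    components because a component is determined by the letters outside
    [i, j+1], the numbers of unbarred and of barred letters and z_{j+1} (it has
    only one lowest element).  In particular c_j exchanges u_j and u_{j+1} and
    fixes z, while t_l exchanges both u_l, u_{l+1} and z_l, z_{l+1}; so both
    sides of (1) permute the u_p, and the z_p, in the same way.  Part (2) is
    part (1) for j = m-1 after exchanging the letters m and \bar m, which
    exchanges the nodes m-1 and m. *)

Set Implicit Arguments.
Unset Strict Implicit.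
Unset Printing Implicit Defensive.

(** Applied to the positions of a row, along which the rank never decreases, this cuts a signature
    into blocks of equal letters. *)
Lemma filter_predU_pairwise (T : eqType) (P Q : pred T) (t : seq T) :
  (forall x, ~~ (P x && Q x)) -> pairwise (fun x y => ~~ (Q x && P y)) t ->
  filter (predU P Q) t = filter P t ++ filter Q t.
Proof.
move=> dPQ; elim: t => //= x t IH /andP[ht pt].
have := dPQ x; rewrite IH //.
case Px: (P x) => /=; first by move=> /negbTE ->.
case Qx: (Q x) => //= _.
suff -> : filter P t = [::] by [].
apply/eqP; rewrite -(negbK (_ == _)) -has_filter -all_predC.
by move: ht; rewrite Qx.
Qed.

(** * Letters and edges in coordinates that treat both spin nodes alike *)

Section Flavour.
Variables (m : nat) (m_gt1 : 1 < m) (s : bool).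

(** Labels outside 1, ..., m fall back on the node labelled 1. *)
Definition ord_of_label (k : nat) : 'I_m :=
  insubd (Ordinal (ltnW m_gt1)) k.-1.
Local Notation o := ord_of_label.

Lemma lab_ord_of_label k : 0 < k <= m -> lab (o k) = k.
Proof. by rewrite /lab val_insubd => h; rewrite ifT; lia. Qed.

Lemma ord_of_labelK : cancel (@lab m) o.
Proof. by move=> a; rewrite /o /lab /= /insubd valK. Qed.

Lemma lab_gt0 (a : 'I_m) : 0 < lab a <= m.
Proof. by rewrite /lab /= ltn_ord. Qed.

Lemma lab_inj : injective (@lab m).
Proof. exact: can_inj ord_of_labelK. Qed.

(* The flavour s = true exchanges the letters m and \bar m, and with them the
   nodes m-1 and m. *)
Definition fcode (x : letter m) : nat * bool :=
  (lab x.1, x.2 (+) (s && (lab x.1 == m))).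

Definition letter_of (x : nat * bool) : letter m :=
  (o x.1, x.2 (+) (s && (x.1 == m))).

(** The labels 1, ..., m-1 stand for a chain of type A_{m-1}; for [s = true] it runs through the
    nodes 1, ..., m-2, m. *)
Definition node (k : nat) : 'I_m := o (if s && (k == m.-1) then m else k).

Lemma fcodeK : cancel fcode letter_of.
Proof.
move=> [a b]; rewrite /fcode /letter_of /= ord_of_labelK.
by rewrite -addbA addbb addbF.
Qed.

Lemma fcode_inj : injective fcode. Proof. exact: can_inj fcodeK. Qed.

Lemma letter_ofK x : 0 < x.1 <= m -> fcode (letter_of x) = x.
Proof.
case: x => p b /= hp.
by rewrite /fcode /= lab_ord_of_label // -addbA addbb addbF.
Qed.

Definition crank (x : nat * bool) : nat := if x.2 then m.*2 - x.1 else x.1.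

(** Exchanging m and \bar m is harmless because both have rank m. *)
Lemma rank_fcode x : rank x = crank (fcode x).
Proof.
rewrite /rank /crank /fcode /=; case: x => a [] /=.
  by case: s; case: eqP => //= ->; lia.
by case: s; case: eqP => //= ->; lia.
Qed.

Lemma lel_fcode x y :
  lel x y = (fcode x == fcode y) || (crank (fcode x) < crank (fcode y)).
Proof. by rewrite /lel (inj_eq fcode_inj) !rank_fcode. Qed.

Lemma lel_trans : transitive (@lel m).
Proof.
move=> y x z; rewrite /lel => /orP[/eqP -> //|xy] /orP[/eqP <-|yz].
  by rewrite xy orbT.
by rewrite (ltn_trans xy yz) orbT.
Qed.

Lemma lel_anti : antisymmetric (@lel m).
Proof. by move=> x y; rewrite /lel => /andP[/orP[/eqP //|xy] /orP[/eqP //|]]; lia. Qed.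

(** For [s = true] and k = m-1, the edges of node m, from m-1 to \bar m and from m to
    \overline{m-1}, take the shape of those of node m-1 once m and \bar m are exchanged. *)
Lemma fedge_node k x y : 0 < k < m ->
  fedge (node k) x y =
  ((fcode x, fcode y) \in [:: ((k, false), (k.+1, false));
                             ((k.+1, true), (k, true))]).
Proof.
move=> hk; rewrite /fedge /node lab_ord_of_label; last by case: ifP; lia.
case: x y => [a b] [a' b']; rewrite /code /fcode /=.
have := lab_gt0 a; have := lab_gt0 a'.
move: (lab a) (lab a') => p p' hp' hp.
rewrite !inE !xpair_eqE.
case: s => /=; last first.
  rewrite !addbF (_ : k < m) ; last by lia.
  by rewrite !inE !xpair_eqE.
case: eqP => [-> | nk].
  rewrite ltnn !inE !xpair_eqE.
  by case: b b' => [] [] /=; lia.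
rewrite (_ : k < m) ?inE ?xpair_eqE; last by lia.
by case: b b' => [] [] /=; lia.
Qed.

Lemma pick_unique (T : finType) (P : pred T) (y : T) :
  (forall z, P z = (z == y)) -> [pick z | P z] = Some y.
Proof.
by move=> h; case: pickP => [z|/(_ y)]; rewrite h ?eqxx // => /eqP ->.
Qed.

Lemma fcode_eq x y : 0 < y.1 <= m -> (fcode x == y) = (x == letter_of y).
Proof. by move=> hy; rewrite -(inj_eq fcode_inj) letter_ofK. Qed.

Lemma f_letter_node k x : 0 < k < m ->
  f_letter (node k) x =
  if fcode x == (k, false) then Some (letter_of (k.+1, false))
  else if fcode x == (k.+1, true) then Some (letter_of (k, true)) else None.
Proof.
move=> hk; rewrite /f_letter; case: ifP => [/eqP e1|n1]; last case: ifP => [/eqP e1|n2].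
- apply: pick_unique => y; rewrite fedge_node // e1 -fcode_eq /=; last lia.
  move: (fcode y) => v.
  by rewrite !inE !xpair_eqE !eqxx /= andbF orbF.
- apply: pick_unique => y; rewrite fedge_node // e1 -fcode_eq /=; last lia.
  move: (fcode y) => v.
  by rewrite !inE !xpair_eqE !eqxx /= andbF.
- case: pickP => // y; rewrite fedge_node // !inE.
  move: (fcode x) (fcode y) n1 n2 => u v n1 n2.
  by rewrite !xpair_eqE n1 n2.
Qed.

Lemma e_letter_node k x : 0 < k < m ->
  e_letter (node k) x =
  if fcode x == (k.+1, false) then Some (letter_of (k, false))
  else if fcode x == (k, true) then Some (letter_of (k.+1, true)) else None.
Proof.
move=> hk; rewrite /e_letter; case: ifP => [/eqP e1|n1]; last case: ifP => [/eqP e1|n2].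
- apply: pick_unique => y; rewrite fedge_node // e1 -fcode_eq /=; last lia.
  move: (fcode y) => v.
  by rewrite !inE !xpair_eqE !eqxx /= !andbF orbF andbT.
- apply: pick_unique => y; rewrite fedge_node // e1 -fcode_eq /=; last lia.
  move: (fcode y) => v.
  by rewrite !inE !xpair_eqE !eqxx /= !andbF /= andbT.
- case: pickP => // y; rewrite fedge_node // !inE.
  move: (fcode x) (fcode y) n1 n2 => u v n1 n2; rewrite !xpair_eqE.
  by rewrite n1 n2 !andbF.
Qed.

End Flavour.

(** * Cancellation of signs *)

Section Cancel.
Variable T : Type.
Implicit Types (A B C D : seq T) (st t : seq (bool * T)).

Lemma cancel_pairs_minus st D t :
  cancel_pairs st (map (pair false) D ++ t) =
  cancel_pairs (rev (map (pair false) D) ++ st) t.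
Proof.
elim: D st => //= d D IH st.
by rewrite IH rev_cons cat_rcons; case: st => [|[] ? ?].
Qed.

Lemma cancel_pairs_plus st A t : all fst st ->
  cancel_pairs st (map (pair true) A ++ t) =
  cancel_pairs (rev (map (pair true) A) ++ st) t.
Proof.
elim: A st => //= a A IH st hst.
rewrite rev_cons cat_rcons -IH //=.
by case: st hst => [|[[] ?] ?].
Qed.

Lemma cancel_pairs_minus_plus B C st t : all fst st ->
  cancel_pairs (map (pair false) B ++ st) (map (pair true) C ++ t) =
  cancel_pairs (rev (map (pair true) (drop (size B) C))
                ++ map (pair false) (drop (size C) B) ++ st) t.
Proof.
move=> hst; elim: B C => [|b B IH] [|c C] //=.
exact: (cancel_pairs_plus (c :: C)).
Qed.

(** Only the minuses of [B] have pluses to their right, those of [C]; cancelling like brackets, they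
    use up the end of [B] and the beginning of [C]. *)
Lemma cancel_pairs_blocks A B C D :
  cancel_pairs [::] (map (pair true) A ++ map (pair false) B
                     ++ map (pair true) C ++ map (pair false) D) =
  map (pair true) A ++ map (pair false) (take (size B - size C) B)
  ++ map (pair true) (drop (size B) C) ++ map (pair false) D.
Proof.
have hA: all fst (rev (map (@pair bool T true) A)) by rewrite all_rev all_map all_predT.
rewrite cancel_pairs_plus // cats0 cancel_pairs_minus -map_rev.
rewrite cancel_pairs_minus_plus // size_rev drop_rev.
rewrite -[map (pair false) D]cats0 cancel_pairs_minus /= cats0.
by rewrite !rev_cat !revK map_rev revK -!catA.
Qed.

Lemma filter_sign (c d : bool) A :
  [seq x.2 | x <- map (pair c) A & x.1 == d] = if c == d then A else [::].
Proof. by elim: A => [|a A /=]; case: (c == d) => //= ->. Qed.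

End Cancel.

(** * Letter multiplicities and explicit crystal operators on rows *)

Section Row.
Variables (m n : nat) (m_gt1 : 1 < m) (s : bool).
Local Notation node := (node m_gt1 s).
Local Notation letter_of := (letter_of m_gt1 s).
Implicit Types (b : B m n) (x y : nat * bool) (h : nat * bool -> nat).

(** An arbitrary weight [h] is allowed because multiplicities, numbers of barred letters and the
    potential in [f_ind] are all sums of this form. *)
Definition weigh b h : nat := \sum_(z <- val b) h (fcode s z).
Definition mult b x : nat := weigh b (fun y => y == x).

Lemma weigh_tnth b h : weigh b h = \sum_(q < n) h (fcode s (tnth b q)).
Proof. by rewrite /weigh big_tuple. Qed.

Definition positions b x : seq 'I_n :=
  [seq q <- enum 'I_n | fcode s (tnth b q) == x].

Lemma mem_positions b x q : (q \in positions b x) = (fcode s (tnth b q) == x).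
Proof. by rewrite mem_filter mem_enum andbT. Qed.

Lemma size_positions b x : size (positions b x) = mult b x.
Proof.
rewrite size_filter /mult weigh_tnth -sum1_count -big_enum /= big_mkcond /=.
by apply: eq_bigr => q _; case: eqP.
Qed.

Lemma row_lel b (q q' : 'I_n) : q < q' -> lel (tnth b q) (tnth b q').
Proof.
case: b => t /= st hqq'.
have x0 := tnth t q.
move: st; rewrite (sorted_pairwise (@lel_trans m)).
move=> /(pairwiseP x0) /(_ q q'); rewrite !(tnth_nth x0); apply => //.
  by rewrite inE size_tuple ltn_ord.
by rewrite inE size_tuple ltn_ord.
Qed.

Lemma fcode_row b q : 0 < (fcode s (tnth b q)).1 <= m.
Proof. exact: lab_gt0. Qed.

Lemma mult_gt0 b x : 0 < mult b x -> exists q, fcode s (tnth b q) = x.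
Proof.
rewrite -size_positions; case E: (positions b x) => [|q t] // _; exists q.
by apply/eqP; rewrite -mem_positions E mem_head.
Qed.

Lemma mult_fcode_gt0 b q : 0 < mult b (fcode s (tnth b q)).
Proof.
by rewrite /mult weigh_tnth (bigD1 q) //= eqxx.
Qed.

(** Entries m and \bar m would have to be comparable for [lel], but they are distinct and of equal
    rank. *)
Lemma mult_m b c : 0 < mult b (m, c) -> mult b (m, ~~ c) = 0.
Proof.
move=> /mult_gt0[q eq]; apply/eqP; rewrite -leqn0 leqNgt; apply/negP.
move=> /mult_gt0[q' eq'].
have: q != q' by apply/eqP => E; move: eq'; rewrite -E eq => -[]; case: c {eq}.
rewrite -val_eqE neq_ltn => /orP[] /row_lel; move=> /(_ b);
  rewrite (lel_fcode m_gt1 s) eq eq' xpair_eqE eqxx /crank /=;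
    case: c {eq eq'} => /=; lia.
Qed.

(** One letter [x] has become [y]. The equation is additive to avoid truncated subtraction;
    indicators [h] give the multiplicities. *)
Definition moved b x y b' : Prop :=
  forall h, weigh b' h + h x = weigh b h + h y.

(** The two order hypotheses make the changed word a row, so that [insub] does not return [None]. *)
Lemma act_at_moved g b p (y : letter m) :
  g (tnth b p) = Some y ->
  (forall q : 'I_n, q < p -> lel (tnth b q) y) ->
  (forall q : 'I_n, p < q -> lel y (tnth b q)) ->
  exists2 b', act_at g b p = Some b' &
    moved b (fcode s (tnth b p)) (fcode s y) b'.
Proof.
move=> gp lt_p gt_p; rewrite /act_at gp /=.
set w := [tuple _ | _ < n].
have sw : sorted (@lel m) w.
  rewrite (sorted_pairwise (@lel_trans m)); apply/(pairwiseP y) => i j.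
  rewrite !inE !size_tuple => hi hj ij.
  rewrite -[i]/(nat_of_ord (Ordinal hi)) -[j]/(nat_of_ord (Ordinal hj)) -!tnth_nth.
  rewrite !tnth_mktuple.
  case: eqP => [ei|_]; case: eqP => [ej|_].
  - by move: ij; rewrite -[i]/(val (Ordinal hi)) ei -ej /= ltnn.
  - by apply: gt_p; rewrite -ei.
  - by apply: lt_p; rewrite -ej.
  - exact: row_lel.
exists (Row sw); first by rewrite insubT.
move=> h; rewrite !weigh_tnth (bigD1 p) //= [in RHS](bigD1 p) //=.
rewrite tnth_mktuple eqxx.
rewrite (eq_bigr (fun q => h (fcode s (tnth b q)))); first by lia.
by move=> q /negbTE nq; rewrite tnth_mktuple nq.
Qed.

Lemma crank_eq x y : 0 < x.1 <= m -> 0 < y.1 <= m -> crank m x = crank m y ->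
  x = y \/ x = (m, ~~ y.2) /\ y.1 = m.
Proof.
case: x y => [p c] [q d]; rewrite /crank /= => hp hq.
case: c d => [] [] h /=; try (by left; congr pair; lia).
  by right; split; [congr pair|]; lia.
by right; split; [congr pair|]; lia.
Qed.

(** Entries after the last [x] have rank at least that of [y]. They can only fail to follow [y] by
    being incomparable with it, which the condition on m excludes. *)
Lemma act_at_raise g b p x y :
  0 < y.1 <= m -> fcode s (tnth b p) = x -> g (tnth b p) = Some (letter_of y) ->
  crank m y = (crank m x).+1 -> (y.1 = m -> mult b (m, ~~ y.2) = 0) ->
  (forall q : 'I_n, p < q -> fcode s (tnth b q) != x) ->
  exists2 b', act_at g b p = Some b' & moved b x y b'.
Proof.
move=> hy ex gp rxy hm hq.
have := @act_at_moved g b p _ gp; rewrite ex letter_ofK //; apply.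
  move=> q /(row_lel b); rewrite !(lel_fcode m_gt1 s) ex letter_ofK //.
  by case: eqP => [-> _|_ /= lt]; rewrite rxy;
    [rewrite ltnSn orbT|rewrite ltnS (ltnW lt) orbT].
move=> q lt_pq; have := row_lel b lt_pq; have := hq q lt_pq.
rewrite !(lel_fcode m_gt1 s) ex letter_ofK // eq_sym => /negbTE -> /=.
rewrite rxy leq_eqVlt => /orP[/eqP E|->]; last by rewrite orbT.
rewrite -rxy in E.
have [->|[e1 e2]] := crank_eq hy (fcode_row b q) E; first by rewrite eqxx.
have [e3|[e3 _]] := crank_eq (fcode_row b q) hy (esym E); first by rewrite e3 eqxx.
have := hm (congr1 fst e1); rewrite -e3 => h0.
by have := mult_fcode_gt0 b q; rewrite h0.
Qed.

Lemma act_at_lower g b p x y :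
  0 < y.1 <= m -> fcode s (tnth b p) = x -> g (tnth b p) = Some (letter_of y) ->
  crank m x = (crank m y).+1 -> (y.1 = m -> mult b (m, ~~ y.2) = 0) ->
  (forall q : 'I_n, q < p -> fcode s (tnth b q) != x) ->
  exists2 b', act_at g b p = Some b' & moved b x y b'.
Proof.
move=> hy ex gp rxy hm hq.
have := @act_at_moved g b p _ gp; rewrite ex letter_ofK //; apply; last first.
  move=> q /(row_lel b); rewrite !(lel_fcode m_gt1 s) ex letter_ofK //.
  case: eqP => [<- _|_ /= lt]; first by rewrite rxy ltnSn orbT.
  by apply/orP; right; lia.
move=> q lt_pq; have := row_lel b lt_pq; have := hq q lt_pq.
rewrite !(lel_fcode m_gt1 s) ex letter_ofK // => /negbTE -> /=.
rewrite rxy ltnS leq_eqVlt => /orP[/eqP E|->]; last by rewrite orbT.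
have [->|[e1 e2]] := crank_eq (fcode_row b q) hy E; first by rewrite eqxx.
have := hm e2; rewrite -e1 => h0.
by have := mult_fcode_gt0 b q; rewrite h0.
Qed.

Lemma sorted_positions b x : sorted (fun q q' : 'I_n => q < q') (positions b x).
Proof.
apply: sorted_filter; first by move=> ? ? ?; apply: ltn_trans.
by have := iota_ltn_sorted 0 n; rewrite -val_enum_ord sorted_map.
Qed.

Lemma positions_rcons b x t p : positions b x = rcons t p ->
  fcode s (tnth b p) = x /\ forall q : 'I_n, p < q -> fcode s (tnth b q) != x.
Proof.
move=> E; split; first by apply/eqP; rewrite -mem_positions E mem_rcons mem_head.
move=> q pq; rewrite -mem_positions E mem_rcons inE; apply/negP => /orP[/eqP ep|qt].
  by move: pq; rewrite ep ltnn.
have := sorted_positions b x; rewrite E sorted_pairwise; last by move=> ? ? ?;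
  apply: ltn_trans.
rewrite pairwise_rcons => /andP[/allP /(_ q qt) qp _].
by move: (ltn_trans pq qp); rewrite ltnn.
Qed.

Lemma positions_cons b x t p : positions b x = p :: t ->
  fcode s (tnth b p) = x /\ forall q : 'I_n, q < p -> fcode s (tnth b q) != x.
Proof.
move=> E; split; first by apply/eqP; rewrite -mem_positions E mem_head.
move=> q pq; rewrite -mem_positions E inE; apply/negP => /orP[/eqP ep|qt].
  by move: pq; rewrite ep ltnn.
have := sorted_positions b x; rewrite E sorted_pairwise; last by move=> ? ? ?;
  apply: ltn_trans.
move=> /= /andP[/allP /(_ q qt) qp _].
by move: (ltn_trans pq qp); rewrite ltnn.
Qed.

Lemma pairwise_fcode b (P Q : pred (nat * bool)) :
  (forall x y, 0 < x.1 <= m -> 0 < y.1 <= m -> P x -> Q y ->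
    x != y /\ crank m x <= crank m y) ->
  pairwise (fun q q' => ~~ (Q (fcode s (tnth b q)) && P (fcode s (tnth b q'))))
    (enum 'I_n).
Proof.
move=> hPQ; have : sorted (fun q q' : 'I_n => q < q') (enum 'I_n).
  by have := iota_ltn_sorted 0 n; rewrite -val_enum_ord sorted_map.
rewrite sorted_pairwise; last by move=> ? ? ?; apply: ltn_trans.
apply: sub_pairwise => q q' /(row_lel b); rewrite (lel_fcode m_gt1 s) => h.
apply/negP => /andP[hQ hP].
have [ne le] := hPQ _ _ (fcode_row b q') (fcode_row b q) hP hQ.
by move: h; rewrite eq_sym (negbTE ne) /= ltnNge le.
Qed.

(** By weakly increasing rank, the letters that carry a sign are k, k+1, \overline{k+1}, \bar k,
    with signs +, -, +, -. For k+1 = m the middle ranks agree, which still forbids the third letter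
    to precede the second. *)
Lemma signature_node k b : 0 < k < m ->
  signature (node k) b =
  map (pair true) (positions b (k, false)) ++
  map (pair false) (positions b (k.+1, false)) ++
  map (pair true) (positions b (k.+1, true)) ++
  map (pair false) (positions b (k, true)).
Proof.
move=> hk; rewrite /signature.
pose P x := fun q => fcode s (tnth b q) == x.
rewrite (eq_filter (a2 := predU (P (k, false)) (predU (P (k.+1, false))
          (predU (P (k.+1, true)) (P (k, true)))))); last first.
  move=> q; rewrite f_letter_node // e_letter_node // /P /=.
  move: (fcode s (tnth b q)) => x.
  by do 4! [case: eqP => //= _].
have D x y q : x != y -> ~~ (P x q && P y q).
  by rewrite /P => /eqP ne; apply/negP => /andP[/eqP e1 /eqP e2]; apply: ne;
    rewrite -e1.
have [n1 n2 n3] : [/\ (k, false) != (k.+1, false), (k, false) != (k.+1, true)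
                      & (k, false) != (k, true)].
  by rewrite !xpair_eqE; split; lia.
have [n4 n5 n6] : [/\ (k.+1, false) != (k.+1, true), (k.+1, false) != (k, true)
                      & (k.+1, true) != (k, true)].
  by rewrite !xpair_eqE; split; lia.
rewrite filter_predU_pairwise; first last.
- apply: (@pairwise_fcode b (pred1 (k, false))
    (predU (pred1 (k.+1, false)) (predU (pred1 (k.+1, true)) (pred1 (k, true))))).
  by move=> x y _ _ /= /eqP -> /or3P[] /eqP ->; split => //; rewrite /crank /=; lia.
- by move=> q; rewrite !inE !andb_orr !negb_or !D.
rewrite filter_predU_pairwise; first last.
- apply: (@pairwise_fcode b (pred1 (k.+1, false))
    ((predU (pred1 (k.+1, true)) (pred1 (k, true))))).
  by move=> x y _ _ /= /eqP -> /orP[] /eqP ->; split => //; rewrite /crank /=; lia.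
- by move=> q; rewrite !inE !andb_orr !negb_or !D.
rewrite filter_predU_pairwise; first last.
- apply: (@pairwise_fcode b (pred1 (k.+1, true)) (pred1 (k, true))).
  by move=> x y _ _ /= /eqP -> /eqP ->; split => //; rewrite /crank /=; lia.
- by move=> q; rewrite D.
rewrite !map_cat; congr (_ ++ (_ ++ (_ ++ _))); apply/eq_in_map => q;
  rewrite mem_filter => /andP[/eqP e1 _]; rewrite f_letter_node // e1.
- by rewrite eqxx.
- by rewrite eq_sym (negbTE n1) (negbTE n4).
- by rewrite eq_sym (negbTE n2) eqxx.
- by rewrite eq_sym (negbTE n3) eq_sym (negbTE n6).
Qed.

Lemma uncancelled_plus k b : 0 < k < m ->
  uncancelled (node k) b true =
  positions b (k, false) ++ drop (mult b (k.+1, false)) (positions b (k.+1, true)).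
Proof.
move=> hk; rewrite /uncancelled signature_node // cancel_pairs_blocks.
by rewrite size_positions !filter_cat !map_cat !filter_sign /= cats0.
Qed.

Lemma uncancelled_minus k b : 0 < k < m ->
  uncancelled (node k) b false =
  take (mult b (k.+1, false) - mult b (k.+1, true)) (positions b (k.+1, false))
  ++ positions b (k, true).
Proof.
move=> hk; rewrite /uncancelled signature_node // cancel_pairs_blocks.
by rewrite !size_positions !filter_cat !map_cat !filter_sign.
Qed.

(** The rightmost uncancelled plus is the last \overline{k+1} when these outnumber the letters k+1,
    and the last k otherwise. *)
Lemma f_nodeP k b : 0 < k < m ->
  match f (node k) b with
  | Some b' =>
      if mult b (k.+1, false) < mult b (k.+1, true)
      then moved b (k.+1, true) (k, true) b'
      else 0 < mult b (k, false) /\ moved b (k, false) (k.+1, false) b'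
  | None => mult b (k.+1, true) <= mult b (k.+1, false) /\ mult b (k, false) = 0
  end.
Proof.
move=> hk; rewrite /f uncancelled_plus //.
case: ltnP => [lt|le].
  move E: (positions b (k.+1, true)) => w; case/lastP: w E => [|t p] E.
    by move: lt; rewrite -[in X in _ < X]size_positions E.
  have [e1 hp] := positions_rcons E.
  rewrite drop_rcons; last first.
    by move: lt; rewrite -[in X in _ < X]size_positions E size_rcons.
  rewrite -rcons_cat rev_rcons /=.
  have [||||b' -> //] := @act_at_raise (f_letter (node k)) b p (k.+1, true) (k,
    true) _ e1 _ _ _ hp.
  - by move=> /=; lia.
  - by rewrite f_letter_node // e1 !xpair_eqE /= eqxx andbF.
  - by rewrite /crank /=; lia.
  - by move=> /=; lia.
rewrite drop_oversize ?size_positions // cats0.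
move E: (positions b (k, false)) => w; case/lastP: w E => [|t p] E.
  by rewrite /= -size_positions E.
have [e1 hp] := positions_rcons E.
rewrite rev_rcons /=.
have [||||b' -> //] := @act_at_raise (f_letter (node k)) b p (k, false) (k.+1,
  false) _ e1 _ _ _ hp.
- by move=> /=; lia.
- by rewrite f_letter_node // e1 eqxx.
- by [].
(* For k+1 = m the new letter m must not meet any \bar m: these are at most as many as the letters
   m, and the two do not both occur. *)
- move=> /= em; move: le; rewrite em.
  by case: (posnP (mult b (m, true))) => // /mult_m; rewrite /=; lia.
- by move=> h; split=> //; rewrite -size_positions E size_rcons.
Qed.

Lemma e_nodeP k b : 0 < k < m ->
  match e (node k) b with
  | Some b' =>
      if mult b (k.+1, true) < mult b (k.+1, false)
      then moved b (k.+1, false) (k, false) b'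
      else 0 < mult b (k, true) /\ moved b (k, true) (k.+1, true) b'
  | None => mult b (k.+1, false) <= mult b (k.+1, true) /\ mult b (k, true) = 0
  end.
Proof.
move=> hk; rewrite /e uncancelled_minus //.
case: ltnP => [lt|le].
  case E: (positions b (k.+1, false)) => [|p t].
    by move: lt; rewrite -[in X in _ < X]size_positions E.
  have [e1 hp] := positions_cons E.
  have -> : mult b (k.+1, false) - mult b (k.+1, true) =
            (mult b (k.+1, false) - mult b (k.+1, true)).-1.+1 by lia.
  rewrite /=.
  have [||||b' -> //] := @act_at_lower (e_letter (node k)) b p (k.+1, false) (k,
    false) _ e1 _ _ _ hp.
  - by move=> /=; lia.
  - by rewrite e_letter_node // e1 !xpair_eqE /= eqxx.
  - by [].
  - by move=> /=; lia.
rewrite (_ : _ - _ = 0) ?take0 /=; last by lia.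
case E: (positions b (k, true)) => [|p t].
  by rewrite /= -size_positions E.
have [e1 hp] := positions_cons E; rewrite /=.
have [||||b' -> //] := @act_at_lower (e_letter (node k)) b p (k, true) (k.+1,
  true) _ e1 _ _ _ hp.
- by move=> /=; lia.
- by rewrite e_letter_node // e1 !xpair_eqE eqxx andbF.
- by rewrite /crank /=; lia.
- move=> /= em; move: le; rewrite em.
  by case: (posnP (mult b (m, false))) => // /mult_m; rewrite /=; lia.
- by move=> h; split=> //; rewrite -size_positions E.
Qed.
End Row.

(** * Maps of rows given by permuting u and z; the toggles *)

Lemma swap_labelK l : involutive (swap_label l).
Proof.
move=> p; rewrite /swap_label.
have [->|pl] := eqVneq p l; first by rewrite eqxx; case: ifP; lia.
have [->|pl'] := eqVneq p l.+1; first by rewrite eqxx.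
by rewrite (negbTE pl) (negbTE pl').
Qed.

Section Acts.
Variables (m n : nat) (m_gt1 : 1 < m) (s : bool).
Local Notation o := (ord_of_label m_gt1).
Local Notation mult := (@mult m n s).
Local Notation weigh := (@weigh m n s).
Implicit Types (b : B m n) (x y : nat * bool) (h g : nat * bool -> nat).

Lemma mult_out b x : ~~ (0 < x.1 <= m) -> mult b x = 0.
Proof.
move=> hx; apply/eqP; rewrite -leqn0 leqNgt; apply/negP => /mult_gt0[q e].
by have := fcode_row s b q; rewrite e (negbTE hx).
Qed.

Lemma mult_count b z : mult b (fcode s z) = count_mem z (val b).
Proof.
rewrite /mult /weigh -sum1_count [RHS]big_mkcond /=; apply: eq_bigr => y _.
by rewrite (inj_eq (fcode_inj m_gt1 (s:=s))); case: eqP.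
Qed.

(** A row is sorted for a transitive and antisymmetric relation, hence determined by its multiset of
    letters. *)
Lemma row_ext b b' :
  (forall x, 0 < x.1 <= m -> mult b x = mult b' x) -> b = b'.
Proof.
case: b b' => [t st] [t' st'] h; apply/val_inj => /=; apply/val_inj => /=.
apply: (sorted_eq (@lel_trans m) (lel_anti m_gt1) st st').
apply/allP => z _ /=; rewrite -!(mult_count (Row _)) h //; exact: lab_gt0.
Qed.

(** Once one of m and \bar m is absent, [lel] is total on the letters that occur. *)
Lemma sort_row (w : seq (letter m)) (c : bool) :
  all (fun z => fcode s z != (m, c)) w ->
  sorted (@lel m) (sort (@lel m) w).
Proof.
apply: sort_sorted_in => y z hy hz.
have {}hy : fcode s y != (m, c) := hy.
have {}hz : fcode s z != (m, c) := hz.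
rewrite !(lel_fcode m_gt1 s) eq_sym.
case: ltngtP => [_|_|E]; rewrite ?orbT ?orbF //.
have [->|[e1 e2]] :=
  crank_eq m_gt1 (lab_gt0 y.1 : 0 < (fcode s y).1 <= m) (lab_gt0 z.1 : 0 < (fcode s
    z).1 <= m) E; first by rewrite eqxx.
move: hy hz; rewrite e1; case: (fcode s z) e2 => p d /= ->.
by rewrite !xpair_eqE eqxx /=; case: c d {e1} => [] [].
Qed.

Lemma row_of_word (w : n.-tuple (letter m)) c :
  all (fun z => fcode s z != (m, c)) w ->
  exists2 b : B m n, val b = [tuple of sort (@lel m) w] &
    forall h, weigh b h = \sum_(z <- w) h (fcode s z).
Proof.
move=> /sort_row hw; exists (@Row m n [tuple of sort (@lel m) w] hw) => // h.
by rewrite /weigh /=; apply: perm_big; rewrite perm_sort.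
Qed.

Lemma sum_letters (F : nat * bool -> nat) :
  \sum_(z : letter m) F (fcode s z) =
  \sum_(a < m) (F (lab a, false) + F (lab a, true)).
Proof.
rewrite -(pair_bigA _ (fun a c => F (fcode s (a, c)))) /=; apply: eq_bigr => a _.
by rewrite big_bool /fcode /=; case: (s && _); rewrite //= addnC.
Qed.

Lemma weigh_mult b h :
  weigh b h = \sum_(a < m) (mult b (lab a, false) * h (lab a, false) +
                            mult b (lab a, true) * h (lab a, true)).
Proof.
rewrite -(sum_letters (fun x => mult b x * h x)).
under eq_bigr => z _ do rewrite /mult /weigh big_distrl /=.
rewrite exchange_big /= /weigh; apply: eq_bigr => y _.
rewrite (bigD1 y) //= eqxx mul1n big1 ?addn0 // => z hz.
by rewrite (inj_eq (fcode_inj m_gt1 (s:=s))) eq_sym (negbTE hz).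
Qed.

Lemma row_of_mult g :
  \sum_(a < m) (g (lab a, false) + g (lab a, true)) = n ->
  (exists c, g (m, c) = 0) ->
  exists b, forall x, 0 < x.1 <= m -> mult b x = g x.
Proof.
move=> gn [c gc]; pose w := flatten [seq nseq (g (fcode s z)) z | z : letter m].
have sw : size w == n.
  rewrite size_flatten /shape sumnE -map_comp big_map big_enum /= -gn -sum_letters.
  by apply/eqP/eq_bigr => z _; rewrite /= size_nseq.
have hw : all (fun z => fcode s z != (m, c)) (Tuple sw).
  apply/allP => z /flatten_mapP[y _ /nseqP[-> g0]].
  by apply/eqP => e; rewrite e gc in g0.
have [b _ hb] := row_of_word hw; exists b => x hx.
rewrite /mult hb /= -(letter_ofK m_gt1 s hx); set z := letter_of _ _ _.
rewrite /w big_flatten big_map big_enum /=.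
under eq_bigr => y _ do rewrite big_nseq iter_addn_0 (inj_eq (fcode_inj m_gt1 (s:=s))).
rewrite (bigD1 z) //= eqxx mul1n big1 ?addn0 // => y /negbTE ->.
by rewrite mul0n.
Qed.

(* u_p (b') = u_{u p} (b) and z_p (b') = z_{v p} (b): the subtraction is
   truncated, and X_p = z_p + max (u_p, 0), Y_p = z_p + max (- u_p, 0). *)
Definition acts (u v : nat -> nat) b b' : Prop := forall p c,
  mult b' (p, c) = minn (mult b (v p, false)) (mult b (v p, true))
                   + (mult b (u p, c) - mult b (u p, ~~ c)).

Lemma acts_ext u v u' v' b b' : u =1 u' -> v =1 v' ->
  acts u v b b' -> acts u' v' b b'.
Proof. by move=> hu hv h p c; rewrite -hu -hv h. Qed.

Lemma acts_inj u v b b1 b2 : acts u v b b1 -> acts u v b b2 -> b1 = b2.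
Proof. by move=> h1 h2; apply: row_ext => -[p c] _; rewrite h1 h2. Qed.

(** Coordinates are pulled back: [b''] at p reads [b'] at [u' p], which reads [b] at [u (u' p)]. *)
Lemma acts_comp u v u' v' b b' b'' :
  acts u v b b' -> acts u' v' b' b'' -> acts (u \o u') (v \o v') b b''.
Proof.
move=> h1 h2 p c; rewrite h2 !h1 /=.
by case: c => /=; lia.
Qed.

Lemma acts_id b : acts id id b b.
Proof. by move=> p [] /=; lia. Qed.

Lemma sum_involutive (u : nat -> nat) (F : nat -> nat) :
  involutive u -> (forall p, 0 < p <= m -> 0 < u p <= m) ->
  \sum_(a < m) F (u (lab a)) = \sum_(a < m) F (lab a).
Proof.
move=> uK um; pose h (a : 'I_m) := o (u (lab a)).
have labh a : lab (h a) = u (lab a) by rewrite lab_ord_of_label // um // lab_gt0.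
have hK : involutive h by move=> a; apply: lab_inj m_gt1 _ _ _; rewrite !labh uK.
rewrite [RHS](reindex_inj (inv_inj hK)); apply: eq_bigr => a _.
by rewrite labh.
Qed.

Lemma weigh1 b : weigh b (fun=> 1) = n.
Proof. by rewrite /weigh sum1_size size_tuple. Qed.

(** Permuting u and z preserves the length, which is the sum of 2 z_p + |u_p|; as [v] fixes m, z_m
    remains 0 and one of m, \bar m stays absent. *)
Lemma acts_exists u v b : involutive u -> involutive v ->
  (forall p, 0 < p <= m -> 0 < u p <= m) ->
  (forall p, 0 < p <= m -> 0 < v p <= m) -> v m = m ->
  exists b', acts u v b b'.
Proof.
move=> uK vK um vm vmm.
pose g x := minn (mult b (v x.1, false)) (mult b (v x.1, true))
                   + (mult b (u x.1, x.2) - mult b (u x.1, ~~ x.2)).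
have [||b' hb'] := @row_of_mult g.
- rewrite -[RHS](weigh1 b) weigh_mult /g /=.
  (* [F] is 2 z_p and [G] is |u_p|, so that F p + G p = X_p + Y_p. *)
  pose F p := (minn (mult b (p, false)) (mult b (p, true))).*2.
  pose G p := (mult b (p, false) - mult b (p, true)) + (mult b (p,
    true) - mult b (p, false)).
  transitivity (\sum_(a < m) (F (v (lab a)) + G (u (lab a)))).
    by apply: eq_bigr => a _; rewrite /F /G; lia.
  rewrite big_split /= (sum_involutive F) // (sum_involutive G) // -big_split /=.
  by apply: eq_bigr => a _; rewrite /F /G; lia.
- have h0 : minn (mult b (m, false)) (mult b (m, true)) = 0.
    by case: (posnP (mult b (m, false))) => [->|/(mult_m m_gt1) /= ->];
      rewrite ?min0n ?minn0.
  case: (leqP (mult b (u m, false)) (mult b (u m, true))) => le.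
    by exists false; rewrite /g /= vmm h0; lia.
  by exists true; rewrite /g /= vmm h0; lia.
exists b' => p c; case: (boolP (0 < p <= m)) => [hp|np]; first by rewrite hb'.
(* Outside 1, ..., m both sides vanish: an involution that preserves this range preserves its
   complement. *)
have out w : involutive w -> (forall p, 0 < p <= m -> 0 < w p <= m) ->
  ~~ (0 < w p <= m).
  by move=> wK wm; apply: contra np => /wm; rewrite wK.
by rewrite !mult_out //= out.
Qed.

(** The toggle exchanges X_l with X_{l+1} and Y_l with Y_{l+1}, hence both u and z. As l+1 < m, it
    leaves m and \bar m alone and so commutes with their exchange. *)
Lemma toggle_acts l b : 0 < l -> l.+1 < m ->
  acts (swap_label l) (swap_label l) b (toggle l b).
Proof.
move=> l_gt0 l_lt.
have tog (z : letter m) : fcode s (toggle_letter l z) = (swap_label l (fcode s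
  z).1, (fcode s z).2).
  have hsw : 0 < swap_label l (lab z.1) <= m.
    by have := lab_gt0 z.1; rewrite /swap_label; case: ifP => ?;
      last case: ifP => ?; lia.
  have hm : (swap_label l (lab z.1) == m) = (lab z.1 == m).
    by rewrite /swap_label; case: ifP => ?; last case: ifP => ?; lia.
  rewrite /toggle_letter (@pick_unique _ _ (o (swap_label l (lab z.1)), z.2)).
    by rewrite /fcode /= lab_ord_of_label // hm.
  move=> [a c]; rewrite /code !xpair_eqE; congr (_ && _).
  by rewrite -(inj_eq (lab_inj m_gt1)) lab_ord_of_label.
have [c hc] : exists c, mult b (m, c) = 0.
  by case: (posnP (mult b (m, false))) => [?|/(mult_m m_gt1) ?];
    [exists false|exists true].
have hw : all (fun z => fcode s z != (m, c)) (map_tuple (toggle_letter l) b).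
  apply/allP => _ /mapP[z zb ->]; apply/negP; rewrite tog => /eqP hz.
  have em : fcode s z = (m, c).
    move: (fcode s z) hz => [p d] /= [e1 ->]; congr pair; move: e1; rewrite /swap_label.
    by case: ifP => ?; last case: ifP => ?; lia.
  by have := mult_count b z; rewrite em hc => /esym/count_memPn; rewrite zb.
have [b' hb' hmul] := row_of_word hw.
have -> : toggle l b = b'.
  apply/val_inj; rewrite /toggle val_insubd -[[tuple of sort _ _]]hb' ifT //.
  exact: (valP b').
have hmu x : mult b' x = mult b (swap_label l x.1, x.2).
  rewrite /mult hmul /= big_map /weigh; apply: eq_bigr => z _.
  rewrite tog; case: x => p d; case: (fcode s z) => q e /=.
  by rewrite !xpair_eqE (inv_eq (swap_labelK l)).
by move=> p d; rewrite hmu /=; case: d => /=; lia.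
Qed.
End Acts.

(** * Permutations of labels and products of toggles *)

Definition reversal (i j p : nat) : nat := if i <= p <= j then i + j - p else p.

Lemma reversalK i j : involutive (reversal i j).
Proof.
by move=> p; rewrite /reversal; case: (boolP (i <= p <= j)) => hp;
  [rewrite ifT; lia|rewrite (negbTE hp)].
Qed.

Lemma reversal_bounds m i j p :
  0 < i -> j <= m -> 0 < p <= m -> 0 < reversal i j p <= m.
Proof. by rewrite /reversal; case: ifP; lia. Qed.

(** The cycle i -> i+1 -> ... -> j -> i, the permutation produced by t_{j-1} ... t_i. *)
Definition rotation (i j p : nat) : nat :=
  if p == j then i else if i <= p < j then p.+1 else p.

Lemma rotation_swap i j : i <= j ->
  rotation i j \o swap_label j =1 rotation i j.+1.
Proof.
move=> ij p; rewrite /rotation /swap_label /=.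
by case: (eqVneq p j) => ?; case: (eqVneq p j.+1) => ?; do ?[case: ifP => ?]; lia.
Qed.

(** The longest permutation of an interval is a cycle followed by that of a shorter interval; each
    use accounts for one factor of the toggle product. *)
Lemma rotation_reversal i j : i <= j ->
  reversal i.+1 j \o rotation i j =1 reversal i j.
Proof.
move=> ij p; rewrite /rotation /reversal /=.
by case: (eqVneq p j) => ?; case: (boolP (i <= p < j)) => ?; do ?[case: ifP => ?]; lia.
Qed.

Section Toggles.
Variables (m n : nat) (m_gt1 : 1 < m) (s : bool).
Implicit Types b : B m n.

Lemma toggles_acts k d b : 0 < k -> k + d < m ->
  acts s (rotation k (k + d)) (rotation k (k + d)) b
    (compose [seq @toggle m n l | l <- rev (iota k d)] b).
Proof.
move=> k_gt0; elim: d => [|d IH] hd.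
  rewrite addn0 /=; apply: (acts_ext _ _ (acts_id m_gt1 s b)) => p;
    rewrite /rotation /=;
    by do ![case: ifP => ?]; lia.
rewrite -addn1 iotaD rev_cat /= addnA addn1.
apply: (acts_ext (rotation_swap (leq_addr d k)) (rotation_swap (leq_addr d k))).
by apply: (acts_comp m_gt1 (IH _) (toggle_acts m_gt1 s _ _ _)); lia.
Qed.

(** As c leaves z alone, the factor c t_{j-1} ... t_k rotates u over [k, j+1] but z only over
    [k, j]. The induction splits off the leftmost factor, which is applied last. *)
Lemma toggle_product_acts (c : B m n -> B m n) i j b :
  (forall b, acts s (swap_label j) id b (c b)) -> 0 < i -> i <= j < m ->
  acts s (reversal i j.+1) (reversal i j) b (toggle_product c i j b).
Proof.
move=> hc; rewrite /toggle_product => i_gt0 /andP[ij jm].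
rewrite [index_iota i j.+1]/index_iota subSn //.
move e_d: (j - i) => d; elim: d i i_gt0 ij e_d => [|d IH] i i_gt0 ij e_d.
  have -> : i = j by lia.
  rewrite /= /index_iota subnn /=.
  apply: (acts_ext _ _ (hc b)) => p; rewrite /reversal /swap_label;
    by do ![case: ifP => ?]; lia.
have ltij : i < j by lia.
have e_d1 : j - i.+1 = d by lia.
have hT := IH i.+1 isT ltij e_d1.
have hI b1 := @toggles_acts i (j - i) b1 i_gt0; rewrite subnKC // in hI.
apply: (acts_ext _ _ (acts_comp m_gt1 hT (acts_comp m_gt1 (hI _ jm) (hc _)))) => p.
  rewrite -(rotation_reversal (leqW ij)).
  by rewrite /= -(rotation_swap ij).
exact: rotation_reversal.
Qed.
End Toggles.

(** * Lowering followed by raising *)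

Section Moves.
Variables (m n : nat) (m_gt1 : 1 < m) (s : bool).
Local Notation node := (node m_gt1 s).
Local Notation mult := (@mult m n s).
Local Notation moved := (@moved m n s).
Implicit Types (b : B m n) (x y : nat * bool).

Lemma moved_mult b x y b' : moved b x y b' ->
  forall z, mult b' z + (x == z) = mult b z + (y == z).
Proof. by move=> h z; exact: h. Qed.

Lemma f_moved k b b' : 0 < k < m -> f (node k) b = Some b' ->
  moved b (k.+1, true) (k, true) b' \/ moved b (k, false) (k.+1, false) b'.
Proof.
move=> hk fb; have := f_nodeP m_gt1 s b hk; rewrite fb.
by case: ifP => _ ?; [left|right; tauto].
Qed.

(** If f_k moved a barred letter, then Y_{k+1} >= X_{k+1} afterwards and e_k moves a barred letter
    back; otherwise X_{k+1} > Y_{k+1} afterwards and an unbarred one returns. *)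
Lemma f_e k b b' : 0 < k < m -> f (node k) b = Some b' -> e (node k) b' = Some b.
Proof.
move=> hk E; have := f_nodeP m_gt1 s b hk; rewrite E => hb.
have := e_nodeP m_gt1 s b' hk.
have [hx1 hx2] : (k == k.+1) = false /\ (k.+1 == k) = false by lia.
move: hb; case: ifP => [lt /moved_mult hb|/negbT le [x0 /moved_mult hb]].
  have := hb (k, true); have := hb (k.+1, true); have := hb (k.+1, false).
  rewrite !xpair_eqE !eqxx ?hx1 ?hx2 /= => h1 h2 h3.
  case: (e _ b') => [b''|]; last by lia.
  case: ifP => [|_ [_ /moved_mult hb']]; first by lia.
  congr Some; apply: (row_ext m_gt1 (s := s)) => z _.
  by have := hb z; have := hb' z; lia.
have := hb (k, false); have := hb (k.+1, true); have := hb (k.+1, false).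
rewrite !xpair_eqE !eqxx ?hx1 ?hx2 /= => h1 h2 h3.
case: (e _ b') => [b''|]; last by lia.
case: ifP => [_ /moved_mult hb'|]; last by lia.
congr Some; apply: (row_ext m_gt1 (s := s)) => z _.
by have := hb z; have := hb' z; lia.
Qed.

End Moves.

(** * Components of the crystal restricted to J, and the reversal of rows *)

Section Components.
Variables (m n : nat) (m_gt1 : 1 < m) (s : bool) (i j : nat).
Hypotheses (i_gt0 : 0 < i) (ij : i <= j) (jm : j < m).
Local Notation o := (ord_of_label m_gt1).
Local Notation node := (node m_gt1 s).
Local Notation mult := (@mult m n s).
Local Notation weigh := (@weigh m n s).
Local Notation moved := (@moved m n s).
Local Notation acts := (acts s (reversal i j.+1) (reversal i j)).
Implicit Types (b : B m n) (x y : nat * bool) (h g : nat * bool -> nat).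

(** For [s = true] and j = m-1 this is {i, ..., m-2, m}. *)
Definition segment : {set 'I_m} := [set a | a \in map node (index_iota i j.+1)].

Lemma segmentP a : reflect (exists2 k, i <= k <= j & a = node k) (a \in segment).
Proof.
rewrite inE; apply: (iffP mapP) => -[k hk ->]; exists k => //.
  by move: hk; rewrite mem_index_iota.
by rewrite mem_index_iota.
Qed.

(* A complete invariant of the components of the crystal restricted to J. *)
Definition same_type b b' : Prop :=
  [/\ forall p c, ~~ (i <= p <= j.+1) -> mult b (p, c) = mult b' (p, c),
      forall c, weigh b (fun x => x.2 == c) = weigh b' (fun x => x.2 == c) &
      minn (mult b (j.+1, false)) (mult b (j.+1, true)) =
      minn (mult b' (j.+1, false)) (mult b' (j.+1, true))].

Lemma same_type_sym b b' : same_type b b' -> same_type b' b.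
Proof. by case=> h1 h2 h3; split=> // p c hp; rewrite h1. Qed.

Lemma same_type_trans b1 b2 b3 :
  same_type b1 b2 -> same_type b2 b3 -> same_type b1 b3.
Proof.
case=> h1 h2 h3 [g1 g2 g3]; split=> [p c hp|c|]; first by rewrite h1 ?g1.
  by rewrite h2 g2.
by rewrite h3 g3.
Qed.

(** Letters stay within [i, j+1] and keep their bar, and f_k changes z_k only, where k <= j. *)
Lemma f_same_type k b b' : i <= k <= j -> f (node k) b = Some b' -> same_type b b'.
Proof.
move=> hk fb; have hkm : 0 < k < m by lia.
have := f_nodeP m_gt1 s b hkm; rewrite fb => hb.
split=> [p c hp|c|].
- by case: (f_moved hkm fb) => /moved_mult /(_ (p, c));
    rewrite !xpair_eqE; lia.
- by case: (f_moved hkm fb) => /(_ (fun x => x.2 == c)) /=; lia.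
- have [kj|nkj] := eqVneq k j; first rewrite kj in hb.
    by move: hb; case: ifP => [lt /moved_mult hb|le [_ /moved_mult hb]];
      have := hb (j.+1, false); have := hb (j.+1, true); rewrite !xpair_eqE /=; lia.
  by case: (f_moved hkm fb) => /moved_mult hb1;
    have := hb1 (j.+1, false); have := hb1 (j.+1, true); rewrite !xpair_eqE /=; lia.
Qed.

Lemma weigh_bar b c : weigh b (fun x => x.2 == c) = \sum_(a < m) mult b (lab a, c).
Proof.
rewrite (weigh_mult m_gt1); apply: eq_bigr => a _ /=.
by case: c; rewrite /= ?muln1 ?muln0 ?addn0.
Qed.

Lemma acts_same_type b b' : acts b b' -> same_type b b'.
Proof.
move=> hb; split=> [p c hp|c|].
- rewrite hb /reversal !ifF; try lia.
  by case: c => /=; lia.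
- rewrite !weigh_bar; under [RHS]eq_bigr => a _ do rewrite hb.
  pose F p := minn (mult b (p, false)) (mult b (p, true)).
  pose G p := mult b (p, c) - mult b (p, ~~ c).
  rewrite big_split /= (sum_involutive m_gt1 F (reversalK i j)); last first.
    by move=> p; apply: reversal_bounds => //; lia.
  rewrite (sum_involutive m_gt1 G (reversalK i j.+1)); last first.
    by move=> p; apply: reversal_bounds => //; lia.
  rewrite -big_split /=; apply: eq_bigr => a _; rewrite /F /G {F G}.
  by case: c => /=; lia.
- rewrite !hb /=; have -> : reversal i j j.+1 = j.+1 by rewrite /reversal ifF; lia.
  lia.
Qed.

Lemma sum_label_inj (F G : nat -> nat) q : 0 < q <= m ->
  (forall p, 0 < p <= m -> p != q -> F p = G p) ->
  \sum_(a < m) F (lab a) = \sum_(a < m) G (lab a) -> F q = G q.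
Proof.
move=> hq FG; rewrite (bigD1 (o q)) //= [in RHS](bigD1 (o q)) //=.
rewrite lab_ord_of_label // (eq_bigr (fun a => G (lab a))); first by lia.
move=> a na; apply: FG; first exact: lab_gt0.
apply: contra na => /eqP e; apply/eqP/(lab_inj m_gt1).
by rewrite lab_ord_of_label.
Qed.

Definition lowest b := forall k, i <= k <= j -> f (node k) b = None.

(** Each vanishing f_k gives X_k = 0 and Y_{k+1} <= X_{k+1}. Combining neighbours, only \bar i, j+1
    and \overline{j+1} survive among the letters with labels in [i, j+1]. *)
Lemma lowest_mult b : lowest b ->
  (forall p, i <= p <= j -> mult b (p, false) = 0) /\
  (forall p, i < p <= j -> mult b (p, true) = 0) /\
  mult b (j.+1, true) <= mult b (j.+1, false).
Proof.
move=> hb; have hk k : i <= k <= j ->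
    mult b (k.+1, true) <= mult b (k.+1, false) /\ mult b (k, false) = 0.
  move=> hk; have hkm : 0 < k < m by lia.
  by have := f_nodeP m_gt1 s b hkm; rewrite hb.
split; first by move=> p /hk[].
split; last by have [] := hk j ltac:(lia).
move=> [//|p] hp; have [] := hk p ltac:(lia); have [] := hk p.+1 ltac:(lia).
lia.
Qed.

(** Here z_{j+1} is Y_{j+1}; the number of unbarred letters then fixes X_{j+1}, and that of barred
    letters fixes Y_i. *)
Lemma lowest_unique b b' : lowest b -> lowest b' -> same_type b b' -> b = b'.
Proof.
move=> /lowest_mult[x0 [y0 le]] /lowest_mult[x0' [y0' le']] [out tot mn].
have yj : mult b (j.+1, true) = mult b' (j.+1, true) by lia.
have xj : mult b (j.+1, false) = mult b' (j.+1, false).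
  have := tot false; rewrite !weigh_bar.
  apply: (@sum_label_inj (fun p => mult b (p, false)) (fun p => mult b' (p,
    false))); first by lia.
  move=> p hp np; case: (boolP (i <= p <= j)) => hpj; first by rewrite x0 // x0'.
  by apply: out; lia.
have yi : mult b (i, true) = mult b' (i, true).
  have := tot true; rewrite !weigh_bar.
  apply: (@sum_label_inj (fun p => mult b (p, true)) (fun p => mult b' (p,
    true))); first by lia.
  move=> p hp np; case: (boolP (i < p <= j)) => hpj; first by rewrite y0 // y0'.
  by have [->//|npj] := eqVneq p j.+1; apply: out; lia.
apply: (row_ext m_gt1 (s := s)) => -[p c] _.
case: (boolP (i <= p <= j.+1)) => [hp|]; last exact: out.
have [->|npj] := eqVneq p j.+1; first by case: c.
have [->|npi] := eqVneq p i.
  by case: c => //; rewrite x0 ?x0' //; lia.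
by case: c; [rewrite y0 ?y0'|rewrite x0 ?x0']; lia.
Qed.

(** The potential of a letter is 2m minus its rank, so each f_k lowers the total by one. *)
Lemma f_ind (P : B m n -> Prop) :
  (forall b, lowest b -> P b) ->
  (forall b k b', i <= k <= j -> f (node k) b = Some b' -> P b' -> P b) ->
  forall b, P b.
Proof.
move=> Plow Pf b; pose pot x := if x.2 then x.1 else m.*2 - x.1.
have [N] := ubnP (weigh b pot); elim: N b => // N IH b hN.
case: (boolP (has (fun k => isSome (f (node k) b)) (index_iota i j.+1))).
  case/hasP => k0; move: (k0 : nat) => k {k0}.
  rewrite mem_index_iota ltnS => hk; case E: (f _ b) => [b'|] // _.
  have hkm : 0 < k < m by lia.
  apply: (Pf b k b' hk E); apply: IH.
  have [e1 e2] : pot (k, false) = (pot (k.+1, false)).+1 /\ pot (k.+1,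
    true) = (pot (k, true)).+1.
    by rewrite /pot /=; split; lia.
  by clearbody pot; case: (f_moved hkm E) => /(_ pot); lia.
move=> /hasPn hb; apply: Plow => k hk.
by have := hb k; rewrite mem_index_iota ltnS => /(_ hk); case: (f _ b).
Qed.

Lemma f_edge k b b' : i <= k <= j -> f (node k) b = Some b' -> edge segment b b'.
Proof.
move=> hk E; apply/existsP; exists (node k).
by rewrite E eqxx /= andbT; apply/segmentP; exists k.
Qed.

Lemma edge_same_type b b' : edge segment b b' -> same_type b b'.
Proof.
case/existsP => a /andP[/segmentP[k hk ->]] /orP[] /eqP E.
  exact: f_same_type hk E.
exact/same_type_sym/(f_same_type hk E).
Qed.

Lemma connect_same_type b b' : connect (edge segment) b b' -> same_type b b'.
Proof.
case/connectP => t; elim: t b => [|b1 t IH] b /= => [_ -> //|/andP[h1 h2] e].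
exact: same_type_trans (edge_same_type h1) (IH _ h2 e).
Qed.

Lemma edge_sym : symmetric (edge segment : rel (B m n)).
Proof.
by move=> b b'; apply: eq_existsb => a; rewrite orbC.
Qed.

(** Applying the f_k joins each row to a lowest one, and two lowest rows of the same type
    coincide. *)
Lemma same_type_connect b b' : same_type b b' -> connect (edge segment) b b'.
Proof.
have low b1 : exists2 l, lowest l & connect (edge segment) b1 l.
  elim/f_ind: b1 => [b1 hb|b1 k b2 hk E [l hl c]]; first by exists b1.
  by exists l => //; apply: connect_trans c; exact/connect1/(f_edge hk E).
have [l hl c] := low b; have [l' hl' c'] := low b' => h.
suff ell : l = l'.
  apply: connect_trans c _.
  by rewrite ell (sym_connect_sym edge_sym).
apply: lowest_unique => //.
apply: same_type_trans (same_type_sym (connect_same_type c)) _.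
exact: same_type_trans h (connect_same_type c').
Qed.

(** With k' = i+j-k, the reversal puts u_{k+1}, u_k at k', k'+1 and z_k at k'. Both f_k and e_{k'}
    lower u_k and raise u_{k+1}, and both raise z_k when u_k > 0 > u_{k+1}, lower it when u_k <= 0
    <= u_{k+1}, and keep it otherwise. *)
Lemma acts_f_e k b cb : i <= k <= j -> acts b cb ->
  match f (node k) b with
  | Some b1 => forall cb1, acts b1 cb1 -> e (node (i + j - k)) cb = Some cb1
  | None => e (node (i + j - k)) cb = None
  end.
Proof.
move=> hk hc; have hkm : 0 < k < m by lia.
set k' := i + j - k; have hk'm : 0 < k' < m by lia.
have := f_nodeP m_gt1 s b hkm; have := e_nodeP m_gt1 s cb hk'm.
have [e1 e2 e3] : [/\ reversal i j k' = k, reversal i j.+1 k' = k.+1 &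
  reversal i j.+1 k'.+1 = k].
  by split; rewrite /reversal; case: ifP => ?; lia.
have := hc k'.+1 true; have := hc k'.+1 false; have := hc k' true; have := hc k' false.
rewrite !e1 !e2 !e3 /=.
(* This index is k-1, or j+1 when k' = j; in both cases it differs from k. *)
set v := reversal i j k'.+1 => c1 c2 c3 c4.
case: (f _ b) => [b1|]; case: (e _ cb) => [cb2|] //; first last.
- by case: ifP => hlt he hf; first lia; case: he; lia.
- by move=> he; case: ifP => hlt hf; first lia; case: hf; lia.
move=> he hf cb1 hc1; congr Some; apply: (row_ext m_gt1 (s := s)) => -[p c] _.
have eC2 q d : q != k' -> q != k'.+1 -> mult cb2 (q, d) = mult cb (q, d).
  move=> n1 n2; case: (ifP _) he => _; [move=> /moved_mult|move=> [_ /moved_mult]];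
    by move=> /(_ (q, d)); rewrite !xpair_eqE; lia.
have eB q d : q != k -> q != k.+1 -> mult b1 (q, d) = mult b (q, d).
  move=> n1 n2; case: (ifP _) hf => _; [move=> /moved_mult|move=> [_ /moved_mult]];
    by move=> /(_ (q, d)); rewrite !xpair_eqE; lia.
have [hx1 hx2] : (k == k.+1) = false /\ (k.+1 == k) = false by lia.
have [hx1' hx2'] : (k' == k'.+1) = false /\ (k'.+1 == k') = false by lia.
(* At q = k+1, either a barred letter in excess leaves or an unbarred one joins when these are at
   least as many, so the minimum stays. *)
have zB q : q != k -> minn (mult b1 (q, false)) (mult b1 (q, true)) =
                      minn (mult b (q, false)) (mult b (q, true)).
  move=> n1; have [->|n2] := eqVneq q k.+1; last by rewrite !eB.
  by move: hf; case: ifP => [lt /moved_mult hb|le [_ /moved_mult hb]];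
    have := hb (k.+1, false); have := hb (k.+1, true);
    rewrite !xpair_eqE !eqxx ?hx1 ?hx2 /=; lia.
have [->|n1] := eqVneq p k'; last have [->|n2] := eqVneq p k'.+1.
- rewrite hc1 e1 e2.
  case: (ifP _) hf => hlt; [move=> /moved_mult hf|move=> [hp /moved_mult hf]];
  (case: (ifP _) he => hlt'; [move=> /moved_mult he|move=> [hp' /moved_mult he]]);
  have := hf (k, false); have := hf (k, true); have := hf (k.+1, false);
  have := hf (k.+1, true); have := he (k', c);
  rewrite !xpair_eqE !eqxx ?hx1 ?hx2 ?hx1' ?hx2' /=; case: c => /=; lia.
- have nv : v != k by rewrite /v /reversal; case: ifP => ?; lia.
  rewrite hc1 e3 -/v zB //.
  case: (ifP _) hf => hlt; [move=> /moved_mult hf|move=> [hp /moved_mult hf]];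
  (case: (ifP _) he => hlt'; [move=> /moved_mult he|move=> [hp' /moved_mult he]]);
  have := hf (k, false); have := hf (k, true);
  have := he (k'.+1, c); have := hc k'.+1 c; rewrite e3 -/v;
  rewrite !xpair_eqE !eqxx ?hx1 ?hx2 ?hx1' ?hx2' /=; case: c => /=; lia.
- rewrite eC2 // hc hc1 zB; last by rewrite /reversal; case: ifP => ?; lia.
  by rewrite !eB // /reversal; case: ifP => ?; lia.
Qed.
End Components.

(** * Signed permutation matrices and inversions *)

Lemma increasing_id (a c : nat) (h : nat -> nat) :
  (forall k, a <= k <= c -> a <= h k <= c) ->
  (forall k, a <= k < c -> h k < h k.+1) -> forall k, a <= k <= c -> h k = k.
Proof.
move=> hac incr k hk.
have lower d : a + d <= c -> a + d <= h (a + d).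
  elim: d => [|d IH] hd; first by have := hac (a + 0); lia.
  by have := incr (a + d); rewrite addnS; lia.
have upper d : d <= c - a -> h (c - d) <= c - d.
  elim: d => [|d IH] hd; first by have := hac (c - 0); lia.
  have := incr (c - d.+1); have -> : (c - d.+1).+1 = c - d by lia.
  lia.
have := lower (k - a); have := upper (c - k); rewrite subnKC ?subKn; lia.
Qed.

Section Weyl.
Variables (m : nat) (m_gt1 : 1 < m) (s : bool).
Local Notation o := (ord_of_label m_gt1).
Local Notation node := (node m_gt1 s).
Implicit Types (p q : 'I_m) (t : {perm 'I_m}).
Import GRing.Theory.

Definition sgn p : int := if s && (lab p == m) then (-1)%R else 1%R.

(** The permutation matrix of [t] conjugated by the diagonal matrix of [sgn]: exchanging m and \bar
    m negates \epsilon_m. *)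
Definition signed_perm_mx t : 'M[int]_m :=
  (\matrix_(p, q) (sgn p * sgn q * (p == t q)%:R))%R.

Lemma sgn_sqr p : (sgn p * sgn p = 1)%R.
Proof. by rewrite /sgn; case: ifP. Qed.

Lemma signed_perm_mx1 : signed_perm_mx 1%g = (1%:M)%R.
Proof.
apply/matrixP => p q; rewrite !mxE perm1.
by case: eqP => [->|_]; rewrite ?sgn_sqr ?mulr1 ?mulr0.
Qed.

Lemma signed_perm_mx_act t (v : 'cV[int]_m) p :
  (signed_perm_mx t *m v)%R p ord0 = (sgn p * sgn (t^-1%g p) * v (t^-1%g p) ord0)%R.
Proof.
rewrite mxE (bigD1 (t^-1%g p)) //= big1 ?addr0 => [|q nq].
  by rewrite mxE permKV eqxx mulr1.
rewrite mxE; case: eqP => [e|_]; last by rewrite mulr0 mul0r.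
by rewrite e permK eqxx in nq.
Qed.

Lemma signed_perm_mxM t t' :
  (signed_perm_mx t *m signed_perm_mx t')%R = signed_perm_mx (t' * t)%g.
Proof.
apply/matrixP => p q; rewrite !mxE (bigD1 (t' q)) //= big1 ?addr0 => [|r nr].
  rewrite !mxE eqxx permM mulr1 mulrAC; congr (_ * _)%R.
  by rewrite -mulrA [(sgn (t' q) * (_ * _))%R]mulrA sgn_sqr mul1r.
by rewrite !mxE (negbTE nr) !mulr0.
Qed.

Lemma signed_perm_mx_inj : injective signed_perm_mx.
Proof.
move=> t t' /matrixP h; apply/permP => q; have := h (t q) q.
rewrite !mxE eqxx mulr1; case: eqP => // _; rewrite mulr0 => /eqP.
by rewrite /sgn; do 2 case: ifP.
Qed.

(** Negating \epsilon_m turns \epsilon_{m-1} + \epsilon_m into \epsilon_{m-1} - \epsilon_m, so both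
    flavours show roots of type A. *)
Lemma alpha_node k p : 0 < k < m ->
  alpha (node k) p ord0 = (sgn p * ((lab p == k)%:R - (lab p == k.+1)%:R))%R.
Proof.
move=> hk; rewrite /alpha /node lab_ord_of_label; last by case: ifP; lia.
rewrite /sgn; have hp := lab_gt0 p.
case: (boolP (s && (k == m.-1))) => [/andP[-> /eqP ->]|hs] /=.
  rewrite ltnn !mxE; have -> : (lab p == m.-1.+1) = (lab p == m) by lia.
  by case: (eqVneq (lab p) m) => h; case: (eqVneq (lab p) m.-1) => h' //=; lia.
rewrite ifT; last by lia.
rewrite !mxE; case: ifP => hs'.
  by case: (eqVneq (lab p) k) => h; case: (eqVneq (lab p) k.+1) => h' //=; lia.
by case: (eqVneq (lab p) k) => h; case: (eqVneq (lab p) k.+1) => h' //=; lia.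
Qed.

Definition adjacent_tperm k := tperm (o k) (o k.+1).
Local Notation tau := adjacent_tperm.

Lemma lab_tau k p : 0 < k < m -> lab (tau k p) = swap_label k (lab p).
Proof.
move=> hk; have [e1 e2] : lab (o k) = k /\ lab (o k.+1) = k.+1.
  by rewrite !lab_ord_of_label; lia.
rewrite /swap_label; case: tpermP => [->|->|n1 n2].
- by rewrite e1 eqxx.
- by rewrite e1 e2 eqxx ifF; lia.
- case: eqP => [e|_]; first by case: n1; rewrite -e ord_of_labelK.
  by case: eqP => [e|_] //; case: n2; rewrite -e ord_of_labelK.
Qed.

Lemma srefl_node k : 0 < k < m -> srefl (node k) = signed_perm_mx (tau k).
Proof.
move=> hk; apply/matrixP => p q.
rewrite /srefl !mxE big_ord1 !mxE !alpha_node //.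
rewrite -[(p == q)](inj_eq (lab_inj m_gt1)) -[(p == tau k q)](inj_eq (lab_inj m_gt1)).
rewrite lab_tau // /swap_label.
have := sgn_sqr p; have: lab p = lab q -> sgn p = sgn q by move=> /(lab_inj m_gt1) ->.
move: (sgn p) (sgn q) (lab p) (lab q) => x y a c.
by case: (eqVneq c k) => h1; case: (eqVneq c k.+1) => h2; case: (eqVneq a k) => h3;
  case: (eqVneq a k.+1) => h4; case: (eqVneq a c) => h5 /=; try lia; nia.
Qed.

Definition inversions t : nat :=
  \sum_(x : 'I_m * 'I_m) ((x.1 < x.2) && (t x.2 < t x.1)).

Lemma inversions1 : inversions 1%g = 0.
Proof. by apply: big1 => -[p q] _; rewrite !perm1 /=; lia. Qed.

(** The transposition is applied before [t]; it permutes the ordered pairs of positions other than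
    (k, k+1), whose status flips. The change of length by one is stated without subtraction. *)
Lemma inversions_tau k t : 0 < k < m ->
  inversions (tau k * t)%g + (t (o k.+1) < t (o k)) =
  inversions t + (t (o k) < t (o k.+1)).
Proof.
move=> hk; have tauK p : tau k (tau k p) = p by rewrite /adjacent_tperm tpermK.
have [e1 e2] : lab (o k) = k /\ lab (o k.+1) = k.+1.
  by rewrite !lab_ord_of_label; lia.
pose h (x : 'I_m * 'I_m) := (tau k x.1, tau k x.2).
have hK : involutive h by case=> p q; rewrite /h /= !tauK.
rewrite {1}/inversions (reindex_inj (inv_inj hK)) /=.
have nab : (o k.+1, o k) != (o k, o k.+1).
  by rewrite xpair_eqE -(inj_eq (lab_inj m_gt1)) e1 e2; lia.
rewrite (bigD1 (o k, o k.+1)) //= (bigD1 (o k.+1, o k)) //=.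
rewrite /inversions [in RHS](bigD1 (o k, o k.+1)) //= [in RHS](bigD1 (o k.+1, o k)) //=.
rewrite !permM !tauK.
have lt_lab p q : (p < q) = (lab p < lab q) by [].
rewrite !lt_lab !lab_tau // !e1 !e2 /swap_label !eqxx.
set S1 := \sum_(_ | _) _; set S2 := \sum_(_ | _) _.
have -> : S1 = S2.
  apply: eq_bigr => -[p q] /=;
    rewrite !xpair_eqE -!(inj_eq (lab_inj m_gt1)) e1 e2 => hpq.
  rewrite !permM !tauK !lt_lab !lab_tau //; congr (nat_of_bool (_ && _)).
  by rewrite /swap_label; do ?[case: ifP => ?]; lia.
by do ![case: ifP => ?]; lia.
Qed.
End Weyl.

(** * The longest element of W_J and the involution theta *)

Section LongestElement.
Variables (m : nat) (m_gt1 : 1 < m) (s : bool) (i j : nat).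
Hypotheses (i_gt0 : 0 < i) (ij : i <= j) (jm : j < m).
Local Notation o := (ord_of_label m_gt1).
Local Notation node := (node m_gt1 s).
Local Notation J := (segment m_gt1 s i j).
Local Notation tau := (adjacent_tperm m_gt1).
Local Notation mx := (signed_perm_mx s).
Implicit Types (p q : 'I_m) (t : {perm 'I_m}) (u v : seq 'I_m).
Import GRing.Theory.

Definition support : {set 'I_m} := [set p | i <= lab p <= j.+1].

Lemma tau_on k : i <= k <= j -> perm_on support (tau k).
Proof.
move=> hk; apply/subsetP => p; rewrite !inE; apply: contraR => hp.
apply/eqP/(lab_inj m_gt1); rewrite lab_tau; last by lia.
by rewrite /swap_label; do ?[case: ifP => ?]; lia.
Qed.

Lemma weyl_word_rcons u (a : 'I_m) : weyl_word (rcons u a) = (weyl_word u *m srefl a)%R.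
Proof.
by rewrite /weyl_word -cats1 big_cat big_seq1.
Qed.

Lemma word_perm u : all (mem J) u ->
  exists t, [/\ perm_on support t, weyl_word u = mx t & inversions t <= size u].
Proof.
elim/last_ind: u => [_|u a IH].
  exists 1%g; rewrite perm_on1 signed_perm_mx1 // (inversions1 m_gt1); split=> //.
  by rewrite /weyl_word big_nil.
rewrite all_rcons => /andP[/segmentP[k hk ->] /IH[t [ht eu le]]].
have hkm : 0 < k < m by lia.
exists (tau k * t)%g; split; first by rewrite perm_onM // tau_on.
  by rewrite weyl_word_rcons eu srefl_node // signed_perm_mxM.
have := inversions_tau m_gt1 t hkm; rewrite size_rcons.
by case: (_ < _); case: (_ < _) => /=; lia.
Qed.

Lemma lab_support t k : perm_on support t -> i <= k <= j.+1 ->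
  i <= lab (t (o k)) <= j.+1.
Proof.
move=> ht hk; have : t (o k) \in support.
  by rewrite (perm_closed _ ht) inE lab_ord_of_label; lia.
by rewrite inE.
Qed.

Lemma increasing_perm t : perm_on support t ->
  (forall k, i <= k <= j -> t (o k) < t (o k.+1)) -> t = 1%g.
Proof.
move=> ht incr; apply/permP => p; rewrite perm1; apply: (lab_inj m_gt1).
case: (boolP (i <= lab p <= j.+1)) => hp; last by rewrite (out_perm ht) // inE.
have := @increasing_id i j.+1 (fun k => lab (t (o k))).
move=> /(_ (fun k => lab_support ht) _ (lab p) hp); rewrite ord_of_labelK; apply.
by move=> k hk; apply: incr; lia.
Qed.

Lemma decreasing_perm t : perm_on support t ->
  (forall k, i <= k <= j -> t (o k.+1) < t (o k)) ->
  forall p, lab (t p) = reversal i j.+1 (lab p).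
Proof.
move=> ht decr p; rewrite /reversal.
case: ifP => hp; last by rewrite (out_perm ht) // inE hp.
(* Composing [t] with the reversal gives an increasing self-map of [i, j+1]. *)
have := @increasing_id i j.+1 (fun k => i + j.+1 - lab (t (o k))).
move=> /(_ _ _ (lab p) hp); rewrite ord_of_labelK => H.
have := lab_support ht hp; rewrite ord_of_labelK.
have : i + j.+1 - lab (t p) = lab p.
  apply: H => k hk; first by have := lab_support ht hk; lia.
  have hk1 : i <= k <= j by lia.
  have := decr _ hk1; rewrite -[_ < _]/(lab (t (o k.+1)) < lab (t (o k))).
  have := @lab_support _ k.+1 ht; have := @lab_support _ k ht; lia.
lia.
Qed.

(** Bubble sort: each descent removed costs one generator and one inversion, and without descents
    only the identity is left. *)
Lemma perm_word t : perm_on support t ->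
  exists u, [/\ all (mem J) u, weyl_word u = mx t & size u = inversions t].
Proof.
have [N] := ubnP (inversions t); elim: N t => // N IH t hN ht.
case: (boolP (has (fun k => t (o k.+1) < t (o k)) (index_iota i j.+1))).
  case/hasP => k0; move: (k0 : nat) => k {k0}.
  rewrite mem_index_iota ltnS => hk desc; have hkm : 0 < k < m by lia.
  have nasc : (t (o k) < t (o k.+1)) = false by lia.
  have inv := inversions_tau m_gt1 t hkm; rewrite desc nasc in inv.
  have [||u [hu eu su]] := IH (tau k * t)%g; [lia|by rewrite perm_onM // tau_on|].
  exists (rcons u (node k)); split.
  - by rewrite all_rcons hu andbT; apply/segmentP; exists k.
  - rewrite weyl_word_rcons eu srefl_node // signed_perm_mxM mulgA.
    by rewrite /adjacent_tperm tperm2 mul1g.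
  - by rewrite size_rcons su; lia.
move=> /hasPn nd; have -> : t = 1%g.
  apply: increasing_perm => // k hk.
  have := nd k; rewrite mem_index_iota ltnS => /(_ hk).
  rewrite -leqNgt leq_eqVlt => /orP[/eqP/val_inj/perm_inj/(congr1 (@lab m))|//].
  by rewrite !lab_ord_of_label; lia.
exists [::]; rewrite (inversions1 m_gt1); split=> //.
by rewrite signed_perm_mx1 /weyl_word big_nil.
Qed.

(** The length in W_J is the number of inversions: [word_perm] bounds it from below and [perm_word]
    attains the bound. *)
Lemma size_reduced u t : perm_on support t -> weyl_word u = mx t ->
  reduced J u -> size u = inversions t.
Proof.
move=> ht eu [hu min]; have [t' [_ eu' le]] := word_perm hu.
have et : t' = t by apply: (@signed_perm_mx_inj _ s); rewrite -eu' eu.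
have [v [hv ev sv]] := perm_word ht.
by apply/eqP; rewrite eqn_leq -{1}sv min ?ev ?eu //= -et.
Qed.

Lemma reduced_size u t : all (mem J) u -> weyl_word u = mx t ->
  size u = inversions t -> reduced J u.
Proof.
move=> hu eu su; split=> // v hv ev; have [t' [_ ev' le]] := word_perm hv.
have et : t' = t by apply: (@signed_perm_mx_inj _ s); rewrite -ev' ev eu.
by rewrite su -et.
Qed.

(** An ascent k would make [rcons u (node k)] a longer reduced word, so the permutation is
    decreasing on [i, j+1]. *)
Lemma longest_perm w : longest J w ->
  exists2 t, w = mx t & forall p, lab (t p) = reversal i j.+1 (lab p).
Proof.
move=> [u [ru <- max]]; have [t [ht eu _]] := word_perm (proj1 ru).
exists t => //; apply: decreasing_perm => // k hk.
have hkm : 0 < k < m by lia.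
rewrite ltnNge leq_eqVlt negb_or; apply/andP; split.
  apply/eqP => /val_inj/perm_inj/(congr1 (@lab m)).
  by rewrite !lab_ord_of_label; lia.
apply/negP => asc.
have su := size_reduced ht eu ru.
have := inversions_tau m_gt1 t hkm; rewrite asc ltnNge (ltnW asc) addn0 => inv.
have /max : reduced J (rcons u (node k)).
  apply: (@reduced_size _ (tau k * t)%g).
  - by rewrite all_rcons (proj1 ru) andbT; apply/segmentP; exists k.
  - by rewrite weyl_word_rcons eu srefl_node // signed_perm_mxM.
  - by rewrite size_rcons su inv; lia.
by rewrite size_rcons; lia.
Qed.

(** A permutation with most inversions provides the witness that keeps [w0] from being the default
    of [xget]. *)
Lemma longest_exists : exists w, longest J w.
Proof.
have [t ht max] : exists2 t, perm_on support t &
    forall t', perm_on support t' -> inversions t' <= inversions t.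
  case: (@arg_maxnP _ 1%g (perm_on support) (@inversions m) (perm_on1 _)) => t ht max.
  by exists t.
have [u [hu eu su]] := perm_word ht; exists (mx t), u; split=> //.
  exact: reduced_size su.
move=> v rv; have [t' [ht' ev _]] := word_perm (proj1 rv).
by rewrite (size_reduced ht' ev rv) su max.
Qed.

Lemma w0_segment :
  exists2 t, w0 J = mx t & forall p, lab (t p) = reversal i j.+1 (lab p).
Proof. exact/longest_perm/(classical_sets.xgetPex 1%:M%R longest_exists). Qed.

Lemma w0_segment_act (v : 'cV[int]_m) p :
  (w0 J *m v)%R p ord0 =
  (sgn s p * sgn s (o (reversal i j.+1 (lab p))) * v (o (reversal i j.+1 (lab p)))
    ord0)%R.
Proof.
have [t -> ht] := w0_segment; rewrite signed_perm_mx_act.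
suff -> : t^-1%g p = o (reversal i j.+1 (lab p)) by [].
apply: (can_inj (permK t)); rewrite permKV; apply: (lab_inj m_gt1).
rewrite ht lab_ord_of_label ?reversalK //.
by apply: reversal_bounds => //; exact: lab_gt0.
Qed.

(** The reversal sends k, k+1 to i+j-k+1, i+j-k, and hence alpha_k to - alpha_{i+j-k}. *)
Lemma theta_segment k : i <= k <= j -> theta J (node k) = node (i + j - k).
Proof.
move=> hk; have hkm : 0 < k < m by lia.
have hk' : 0 < i + j - k < m by lia.
have alpha_theta : (- (w0 J *m alpha (node k)))%R = alpha (node (i + j - k)).
  apply/matrixP => p z; rewrite (ord1 z) mxE w0_segment_act !alpha_node //.
  rewrite lab_ord_of_label; last by apply: reversal_bounds => //; exact: lab_gt0.
  rewrite !(inv_eq (reversalK i j.+1)).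
  have -> : reversal i j.+1 k = (i + j - k).+1 by rewrite /reversal; case: ifP; lia.
  have -> : reversal i j.+1 k.+1 = i + j - k by rewrite /reversal; case: ifP; lia.
  by rewrite mulrA -[(_ * _ * sgn _ _)%R]mulrA sgn_sqr mulr1 -mulrN opprB.
rewrite /theta (@pick_unique _ _ (node (i + j - k))) // => a.
rewrite alpha_theta; apply/andP/eqP => [[/segmentP[l hl ->] /eqP e]|->]; last first.
  by split=> //; apply/segmentP; exists (i + j - k) => //; lia.
(* At coordinate l the root alpha_l has entry [sgn], while alpha_{i+j-k} has 0 or the opposite
   unless l = i+j-k. *)
have := congr1 (fun M : 'cV[int]_m => M (o l) ord0) e.
have hlm : 0 < l < m by lia.
rewrite !alpha_node // lab_ord_of_label; last by lia.
move=> h; congr node; move: h.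
rewrite eqxx (_ : (l == l.+1) = false); last by lia.
case: (eqVneq l (i + j - k)) => // h1.
by rewrite /sgn; case: ifP => _; case: eqP => _ /=.
Qed.
End LongestElement.

(** * The cactus action as the reversal of u and z *)

Section Cactus.
Variables (m n : nat) (m_gt1 : 1 < m) (s : bool) (i j : nat).
Hypotheses (i_gt0 : 0 < i) (ij : i <= j) (jm : j < m).
Local Notation o := (ord_of_label m_gt1).
Local Notation node := (node m_gt1 s).
Local Notation J := (segment m_gt1 s i j).
Local Notation mult := (@mult m n s).
Local Notation acts := (acts s (reversal i j.+1) (reversal i j)).
Implicit Types (b : B m n) (c : {ffun B m n -> B m n}).
Import GRing.Theory.

Lemma wt_letter_fcode (z : letter m) (p : 'I_m) :
  wt_letter z p ord0 =
  (sgn s p * ((fcode s z == (lab p, false))%:Z - (fcode s z == (lab p, true))%:Z))%R.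
Proof.
case: z => a d; rewrite /wt_letter /fcode /sgn !xpair_eqE /=.
case: (eqVneq (lab a) (lab p)) => [e|ne].
  by case: d; rewrite /= !mxE e eqxx; case: (s && _).
by case: d; rewrite /= !mxE (eq_sym (lab p)) (negbTE ne); case: (s && _).
Qed.

Lemma wt_mult b (p : 'I_m) :
  wt b p ord0 =
  (sgn s p * ((mult b (lab p, false))%:Z - (mult b (lab p, true))%:Z))%R.
Proof.
rewrite /wt summxE /mult !weigh_tnth !(big_morph Posz PoszD (erefl _)) -sumrB mulr_sumr.
by apply: eq_bigr => q _; rewrite wt_letter_fcode.
Qed.

(** Up to [sgn], the coordinates of the weight are the u_p, on which w_{0,J} acts by the same
    reversal. *)
Lemma acts_wt b b' : acts b b' -> wt b' = (w0 J *m wt b)%R.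
Proof.
move=> hb; apply/matrixP => p z; rewrite (ord1 z) w0_segment_act // !wt_mult !hb /=.
rewrite lab_ord_of_label; last by apply: reversal_bounds => //; exact: lab_gt0.
rewrite mulrA -[(_ * _ * sgn _ _)%R]mulrA sgn_sqr mulr1; congr (_ * _)%R.
lia.
Qed.

Lemma acts_sym b b' : acts b b' -> acts b' b.
Proof.
move=> hb p d; rewrite !hb !reversalK.
by case: d => /=; lia.
Qed.

Section Spec.
Variable c : {ffun B m n -> B m n}.
Hypothesis c_acts : forall b, acts b (c b).

Lemma acts_involutive : involutive c.
Proof. by move=> b; apply: (acts_inj m_gt1 (c_acts (c b))); exact: acts_sym. Qed.

Lemma acts_e b k : i <= k <= j -> e (node (i + j - k)) (c b) = omap c (f (node k) b).
Proof.
move=> hk; have := acts_f_e m_gt1 i_gt0 ij jm hk (c_acts b).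
by case: (f _ b) => // b1 /(_ _ (c_acts b1)).
Qed.

Lemma acts_cactus_spec : cactus_spec J c.
Proof.
move=> b; split=> [||a /segmentP[k hk ->]].
- apply: (same_type_connect m_gt1 i_gt0 ij jm).
  exact: (acts_same_type m_gt1 i_gt0 ij jm (c_acts b)).
- exact: acts_wt.
- rewrite theta_segment //; split.
    by rewrite -acts_e; [congr (e (node _) _)|]; lia.
  (* The relation for f comes from the one for e at [c b], because c is an involution. *)
  have := acts_e (c b) hk; rewrite acts_involutive => ->.
  case: (f _ (c b)) => //= b1; by rewrite acts_involutive.
Qed.

(** The composite of c' and c commutes with the f_k and preserves components. It fixes each lowest
    row, the only one in its component, and then every row by [f_ind] because the f_k are
    injective. *)
Lemma cactus_spec_unique (c' : {ffun B m n -> B m n}) : cactus_spec J c' -> c' = c.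
Proof.
move=> hc'; have D b : c' (c b) = b.
  have Df b1 k : i <= k <= j -> f (node k) (c' (c b1)) = omap (c' \o c) (f (node k) b1).
    move=> hk; have nJ : node k \in J by apply/segmentP; exists k.
    have [_ _ /(_ _ nJ)[_ ->]] := hc' (c b1).
    by rewrite theta_segment // acts_e //; case: (f _ b1).
  have Dt b1 : same_type s i j b1 (c' (c b1)).
    apply: same_type_trans (acts_same_type m_gt1 i_gt0 ij jm (c_acts b1)) _.
    by have [/(connect_same_type i_gt0 ij jm)] := hc' (c b1).
  apply: (@f_ind m n m_gt1 s i j _ _ _ (fun b => c' (c b) = b)) b => // [b hb|b k
    b' hk E IH].
    apply/esym/(lowest_unique i_gt0 ij jm hb _ (Dt b)) => k hk.
    by rewrite Df // hb.
  have := Df b k hk; rewrite E /= IH => E'.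
  have hkm : 0 < k < m by lia.
  by have := f_e hkm E; rewrite (f_e hkm E') => -[].
by apply/ffunP => b; rewrite -{1}(acts_involutive b) D.
Qed.
End Spec.

(** The reversal exists as a map, since j < m keeps m fixed on z; it meets the specification, and by
    uniqueness [xget] can return no other map. *)
Lemma cactus_acts b : acts b (cactus n J b).
Proof.
have ex b1 : exists b', acts b1 b'.
  apply: (acts_exists m_gt1); try exact: reversalK.
  - by move=> p; apply: reversal_bounds; lia.
  - by move=> p; apply: reversal_bounds; lia.
  - by rewrite /reversal ifF //; lia.
have [g hg] := boolp.choice ex.
pose c : {ffun B m n -> B m n} := [ffun b1 => g b1].
have c_acts b1 : acts b1 (c b1) by rewrite ffunE.
have := classical_sets.xgetPex [ffun b1 => b1] (ex_intro _ c (acts_cactus_spec c_acts)).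
by rewrite -/(cactus n J) => /(cactus_spec_unique c_acts) ->.
Qed.

End Cactus.

(** * Comparison of the cactus action with products of toggles *)

Section Main.
Variables (m n : nat) (m_gt1 : 1 < m) (s : bool).
Local Notation node := (node m_gt1 s).

(** For i = j the reversal of [j, j+1] is a swap of u and that of [j, j] is trivial on z. *)
Lemma cactus_node_acts j (b : B m n) : 0 < j < m ->
  acts s (swap_label j) id b (cactus n [set node j] b).
Proof.
move=> hj; have -> : [set node j] = segment m_gt1 s j j.
  apply/setP => a; rewrite inE; apply/eqP/segmentP => [->|[k hk ->]].
    by exists j; rewrite // leqnn.
  by have -> : k = j by lia.
have := @cactus_acts m n m_gt1 s j j _ _ _ b.
move=> /(_ ltac:(lia) ltac:(lia) ltac:(lia)).
by apply: acts_ext => p; rewrite /reversal /swap_label; do ?[case: ifP => ?]; lia.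
Qed.

Lemma cactus_toggle_product i j : 0 < i <= j -> j < m ->
  cactus n (segment m_gt1 s i j) =1
  toggle_product (cactus n [set node j]) i j.
Proof.
move=> /andP[i_gt0 ij] jm b;
  apply: (acts_inj m_gt1 (@cactus_acts m n m_gt1 s i j i_gt0 ij jm b)).
apply: toggle_product_acts; rewrite ?ij // => b1.
by apply: cactus_node_acts; lia.
Qed.
End Main.

Theorem theorem6p5 (m : nat) (hm : 3 <= m) :
  (forall i j : nat, 1 <= i -> i < j -> j <= m.-1 ->
   forall n : nat, 1 <= n ->
     cactus n [set k : 'I_m | i <= lab k <= j]
       =1 toggle_product (@cactus1 m n j) i j)
  /\
  (forall i : nat, 1 <= i -> i <= m.-2 ->
   forall n : nat, 1 <= n ->
     cactus n [set k : 'I_m | (i <= lab k <= m.-2) || (lab k == m)]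
       =1 toggle_product (@cactus1 m n m) i m.-1).
Proof.
have m_gt1 : 1 < m by lia.
have lab_node s k : 0 < k < m ->
  lab (node m_gt1 s k) = if s && (k == m.-1) then m else k.
  by move=> hk; rewrite lab_ord_of_label //; case: ifP; lia.
split=> [i j i_gt0 ij jm n _|i i_gt0 im n _].
(* Part (1) is the flavour [s = false]. *)
- have -> : [set k : 'I_m | i <= lab k <= j] = segment m_gt1 false i j.
    apply/setP => a; rewrite inE; apply/idP/segmentP => [ha|[k hk ->]].
      by exists (lab a) => //; rewrite /node /= ord_of_labelK.
    by rewrite lab_node //=; lia.
  have -> : @cactus1 m n j = cactus n [set node m_gt1 false j].
    rewrite /cactus1; congr (fun_of_fin (cactus n _)); apply/setP => a.
    by rewrite !inE -(inj_eq (lab_inj m_gt1)) lab_node //; lia.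
  by apply: cactus_toggle_product; lia.
(* Part (2) is the flavour [s = true] with j = m-1, where [node] sends m-1 to the node m. *)
- have -> : [set k : 'I_m | (i <= lab k <= m.-2) || (lab k == m)] =
            segment m_gt1 true i m.-1.
    apply/setP => a; rewrite inE; apply/idP/segmentP => [ha|[k hk ->]].
      have := lab_gt0 a => la.
      exists (if lab a == m then m.-1 else lab a); first by case: ifP; lia.
      apply: (lab_inj m_gt1); rewrite lab_node /=; do ?[case: ifP]; lia.
    by rewrite lab_node /=; last lia; case: ifP; lia.
  have -> : @cactus1 m n m = cactus n [set node m_gt1 true m.-1].
    rewrite /cactus1; congr (fun_of_fin (cactus n _)); apply/setP => a.
    by rewrite !inE -(inj_eq (lab_inj m_gt1)) lab_node /= ?eqxx //; lia.
  by apply: cactus_toggle_product; lia.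
Qed.
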